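(* Let $(X,d,\mu,\mathcal{E},\mathcal{F})$ be a Dirichlet space satisfying the standing assumptions (A1)–(A3), (HK), (BE) stated in the context, and let $0<\delta<1$. Assume $\alpha_1^{\#}=1$. For a function $f$ on $X$ write $E_t(f)=\{x\in X: f(x)>t\}$. There exist constants $C_1,C_2>0$ such that for any non-negative $f\in L^1(X,\mu)$, $$C_1\int_0^\infty\|\mathbf{1}_{E_t(f)}\|_{1,1}\,dt\le\|f\|_{1,1}\le C_2\int_0^\infty\|\mathbf{1}_{E_t(f)}\|_{1,1}\,dt.$$ In particular, for non-negative $f\in\mathbf{B}^{1,1}(X)$ one has $\mathbf{1}_{E_t(f)}\in\mathbf{B}^{1,1}(X)$ for almost every $t>0$. Conversely, for non-negative $f\in L^1(X,\mu)$, if $\mathbf{1}_{E_t(f)}\in\mathbf{B}^{1,1}(X)$ for almost every $t>0$ and $\int_0^\infty\|\mathbf{1}_{E_t(f)}\|_{1,1}\,dt<\infty$, then $f\in\mathbf{B}^{1,1}(X)$.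
   Context: Setting. $(X,d,\mu)$ is a locally compact metric measure space, $\mu$ a Radon measure supported on $X$, and $(\mathcal{E},\mathcal{F})$ is a Dirichlet form on $L^2(X,\mu)$ with heat semigroup $\{P_t\}_{t>0}$ and generator $L$. Write $B(x,r)=\{y: d(x,y)<r\}$. For $\lambda>0$, $1\le p<\infty$, $KS^{\lambda,p}(X)$ is the set of $f\in L^p(X,\mu)$ with $\limsup_{r\to0^+}\int_X\int_{B(x,r)}\frac{|f(x)-f(y)|^p}{r^{\lambda p}\mu(B(x,r))}d\mu(y)d\mu(x)<\infty$. Standing assumptions. (A1) Every ball $B(x,r)$ has compact closure. (A2) There are $c_1,c_2,d_H>0$ with $c_1r^{d_H}\le\mu(B(x,r))\le c_2r^{d_H}$ for all $x\in X$, $r\ge0$. (A3) $(\mathcal{E},\mathcal{F})$ is regular and strongly local. (HK) $\{P_t\}$ has a continuous heat kernel $p_t(x,y)$ and there are $c_3,c_4,c_5,c_6\in(0,\infty)$, $d_W\in[2,\infty)$ with $c_5t^{-d_H/d_W}\exp(-c_6(d(x,y)^{d_W}/t)^{1/(d_W-1)})\le p_t(x,y)\le c_3t^{-d_H/d_W}\exp(-c_4(d(x,y)^{d_W}/t)^{1/(d_W-1)})$ for $\mu\times\mu$-a.e. $(x,y)$ and every $t>0$. (BE) There is $C>0$ such that $|P_tg(x)-P_tg(y)|\le C\frac{d(x,y)^\kappa}{t^{\kappa/d_W}}\|g\|_{L^\infty(X,\mu)}$ for all $t>0$, $g\in L^\infty(X,\mu)$, $x,y\in X$, where $0<\kappa<d_W$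 is defined by $d_W-\kappa=\sup\{\lambda>0: KS^{\lambda,1}(X)\text{ contains non-constant functions}\}$. Subordinated semigroup. For fixed $0<\delta<1$ let $\eta^{(\delta)}_t\ge0$ be the continuous function with $\int_0^\infty\eta^{(\delta)}_t(s)e^{-s\lambda}ds=e^{-t\lambda^\delta}$ for $\lambda>0$. The semigroup with generator given by the fractional Laplacian $(-L)^\delta$ is $P^{(\delta)}_tf=\int_0^\infty\eta^{(\delta)}_t(s)P_sf\,ds$, with heat kernel $p^{(\delta)}_t(x,y)=\int_0^\infty\eta^{(\delta)}_t(s)p_s(x,y)ds$. Besov classes. For $p\ge1$, $\alpha\ge0$: $\|f\|_{p,\alpha}=\sup_{t>0}t^{-\alpha}\left(\int_X\int_X|f(x)-f(y)|^pp^{(\delta)}_t(x,y)d\mu(x)d\mu(y)\right)^{1/p}\in[0,\infty]$ and $\mathbf{B}^{p,\alpha}(X)=\{f\in L^p(X,\mu):\|f\|_{p,\alpha}<\infty\}$. The $L^1$ critical exponent is $\alpha_1^{\#}=\sup\{\alpha>0:\mathbf{B}^{1,\alpha}(X)\text{ contains non-constant functions}\}$; the condition $\alpha_1^{\#}=1$ is equivalent to $\delta\le1-\frac{\kappa}{d_W}$. *)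

(* Defs.v *)
From HB Require Import structures.
From mathcomp Require Import all_boot all_order all_algebra.
From mathcomp Require Import all_classical all_reals all_analysis.

Set Implicit Arguments.
Unset Strict Implicit.
Unset Printing Implicit Defensive.
Import Order.TTheory GRing.Theory Num.Theory.
Import numFieldNormedType.Exports.

Local Open Scope classical_set_scope.
Local Open Scope ring_scope.

HB.mixin Record isBorel (d : measure_display) (R : realType) T
    & Metric R T & Measurable d T := {
  borel_measurableE : (@measurable d T) = <<s (@open T) >>
}.

#[short(type="borelMetricType")]
HB.structure Definition BorelMetric (d : measure_display) (R : realType) :=
  { T of Metric R T & Measurable d T & isBorel d R T }.

Section metric_measure_space.
Context (d : measure_display) (R : realType) (X : borelMetricType d R).
Context (mu : {measure set X -> \bar R}).

Definition radon_measure : Prop :=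
  [/\ forall K, compact K -> (mu K < +oo)%E,
      forall U, open U ->
        mu U = ereal_sup [set mu K | K in [set K | compact K /\ K `<=` U]]
    & forall A, measurable A ->
        mu A = ereal_inf [set mu U | U in [set U | open U /\ A `<=` U]] ].

Definition full_support : Prop :=
  forall U : set X, open U -> U !=set0 -> (0 < mu U)%E.

Definition balls_relatively_compact : Prop :=
  forall (x : X) (r : R), compact (closure (ball x r)).

Definition ahlfors_regular (dH : R) : Prop :=
  0 < dH /\ exists c1 c2 : R, [/\ 0 < c1, 0 < c2
    & forall (x : X) (r : R), 0 <= r ->
        ((c1 * r `^ dH)%:E <= mu (ball x r) <= (c2 * r `^ dH)%:E)%E ].

(* Functions are representatives, so being constant is meant almost everywhere *)
Definition nonconstant (f : X -> R) : Prop :=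
  ~ exists c : R, \forall x \ae mu, f x = c.

Definition L2norm (f : X -> R) : \bar R := 'N[mu]_2%:E[EFin \o f].

Definition L2dot (f g : X -> R) : R := \int[mu]_x (f x * g x).

(* A form is a domain [F] of square-integrable functions and
    a function [E] which is meaningful on [F] only. *)

Definition form1 (E : (X -> R) -> (X -> R) -> R) (u : X -> R) : R :=
  E u u + L2dot u u.

Record dirichlet_form (F : set (X -> R)) (E : (X -> R) -> (X -> R) -> R)
    : Prop := DirichletForm {
  form_L2 : forall u, F u -> u \in Lfun mu 2%:E ;
  form_ae : forall u v, F u -> v \in Lfun mu 2%:E ->
    (\forall x \ae mu, v x = u x) ->
    F v /\ forall w, F w -> E v w = E u w ;
  form_dom0 : F (cst 0) ;
  form_domP : forall (a : R) u v, F u -> F v -> F (fun x => a * u x + v x) ;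
  form_linear : forall (a : R) u v w, F u -> F v -> F w ->
    E (fun x => a * u x + v x) w = a * E u w + E v w ;
  form_sym : forall u v, F u -> F v -> E u v = E v u ;
  form_ge0 : forall u, F u -> 0 <= E u u ;
  form_dense : forall f, f \in Lfun mu 2%:E -> forall e : R, 0 < e ->
    exists2 u, F u & (L2norm (fun x => f x - u x)%R < e%:E)%E ;
  form_closed : forall u_ : nat -> X -> R, (forall n, F (u_ n)) ->
    (forall e : R, 0 < e -> exists N : nat, forall m n : nat,
       (N <= m)%N -> (N <= n)%N ->
       form1 E (fun x => u_ m x - u_ n x) < e) ->
    exists2 u, F u & form1 E (fun x => u_ n x - u x) @[n --> \oo] --> (0 : R) ;
  form_markov : forall u, F u ->
    let v := fun x => Num.min (Num.max (u x) 0) 1 in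
    F v /\ E v v <= E u u
}.

Definition Cc (f : X -> R) : Prop :=
  continuous f /\ compact (closure [set x | f x != 0]).

Definition regular_form (F : set (X -> R)) (E : (X -> R) -> (X -> R) -> R)
    : Prop :=
  (forall u, F u -> forall e : R, 0 < e ->
     exists v, [/\ F v, Cc v & form1 E (fun x => u x - v x) < e]) /\
  (forall f, Cc f -> forall e : R, 0 < e ->
     exists v, [/\ F v, Cc v & forall x, `|f x - v x| < e]).

(* The support of the measure |u| mu: the complement of the largest open set on
   which u vanishes almost everywhere. *)
Definition ae_support (u : X -> R) : set X :=
  ~` \bigcup_(U in [set U | open U /\ \forall x \ae mu, U x -> u x = 0]) U.

Definition strongly_local (F : set (X -> R)) (E : (X -> R) -> (X -> R) -> R)
    : Prop :=
  forall u v, F u -> F v ->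
    compact (ae_support u) -> compact (ae_support v) ->
    (exists (U : set X) (c : R), [/\ open U, ae_support u `<=` U
       & \forall x \ae mu, U x -> v x = c]) ->
    E u v = 0.

Record L2_contraction_semigroup (P : R -> (X -> R) -> X -> R) : Prop :=
  L2ContractionSemigroup {
  sg_L2 : forall t f, 0 < t -> f \in Lfun mu 2%:E -> P t f \in Lfun mu 2%:E ;
  sg_linear : forall t (a : R) f g, 0 < t ->
    f \in Lfun mu 2%:E -> g \in Lfun mu 2%:E ->
    \forall x \ae mu, P t (fun y => a * f y + g y) x = a * P t f x + P t g x ;
  sg_contraction : forall t f, 0 < t -> f \in Lfun mu 2%:E ->
    (L2norm (P t f) <= L2norm f)%E ;
  sg_sym : forall t f g, 0 < t ->
    f \in Lfun mu 2%:E -> g \in Lfun mu 2%:E ->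
    L2dot (P t f) g = L2dot f (P t g) ;
  sg_add : forall s t f, 0 < s -> 0 < t -> f \in Lfun mu 2%:E ->
    \forall x \ae mu, P (s + t) f x = P s (P t f) x ;
  sg_continuous : forall f, f \in Lfun mu 2%:E ->
    L2norm (fun x => P t f x - f x) @[t --> (0 : R)^'+] --> 0%E
}.

(* [h] is the value at [u] of the infinitesimal generator of [P] *)
Definition semigroup_generator (P : R -> (X -> R) -> X -> R) (u h : X -> R)
    : Prop :=
  [/\ u \in Lfun mu 2%:E, h \in Lfun mu 2%:E
    & L2norm (fun x => (P t u x - u x) / t - h x)
        @[t --> (0 : R)^'+] --> 0%E ].

(* [h] is the value at [u] of the self-adjoint operator L of the form, with the
   sign convention E(u,v) = - <L u, v> *)
Definition form_generator (F : set (X -> R)) (E : (X -> R) -> (X -> R) -> R)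
    (u h : X -> R) : Prop :=
  [/\ F u, h \in Lfun mu 2%:E & forall v, F v -> E u v = - L2dot h v ].

Definition heat_semigroup (F : set (X -> R)) (E : (X -> R) -> (X -> R) -> R)
    (P : R -> (X -> R) -> X -> R) : Prop :=
  L2_contraction_semigroup P /\
  forall u h, semigroup_generator P u h <-> form_generator F E u h.

Definition kernel_op (p : R -> X -> X -> R) (t : R) (f : X -> R) (x : X) : R :=
  \int[mu]_y (p t x y * f y).

Definition continuous_heat_kernel (P : R -> (X -> R) -> X -> R)
    (p : R -> X -> X -> R) : Prop :=
  (forall (t : R) (x y : X), 0 < t ->
     {for (t, x, y), continuous (fun z : R * X * X => p z.1.1 z.1.2 z.2)}) /\
  (forall t f, 0 < t -> f \in Lfun mu 2%:E ->
     \forall x \ae mu, P t f x = kernel_op p t f x).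

Definition sub_gaussian (dH dW c c' t : R) (x y : X) : R :=
  c * t `^ (- dH / dW) *
  expR (- c' * (mdist x y `^ dW / t) `^ ((dW - 1)^-1)).

Definition heat_kernel_estimates (dH dW : R) (p : R -> X -> X -> R) : Prop :=
  2 <= dW /\ exists c3 c4 c5 c6 : R, [/\ 0 < c3, 0 < c4, 0 < c5, 0 < c6
    & forall t : R, 0 < t -> \forall z \ae (mu \x mu)%E,
        sub_gaussian dH dW c5 c6 t z.1 z.2 <= p t z.1 z.2
          <= sub_gaussian dH dW c3 c4 t z.1 z.2 ].

Definition KS_energy (lam p : R) (f : X -> R) (r : R) : \bar R :=
  (\int[mu]_x \int[mu]_(y in ball x r)
     ((`|f x - f y| `^ p) / (r `^ (lam * p) * fine (mu (ball x r))))%:E)%E.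

Definition KS (lam p : R) : set (X -> R) :=
  [set f | f \in Lfun mu p%:E /\
     (limf_esup (KS_energy lam p f) ((0 : R)^'+) < +oo)%E].

Definition KS_critical_exponent : \bar R :=
  ereal_sup [set lam%:E | lam in
    [set lam : R | 0 < lam /\ exists2 f, KS lam 1 f & nonconstant f]].

(* For bounded g, P_t g is the everywhere defined version given by the
   continuous heat kernel. *)
Definition weak_bakry_emery (kappa dW : R) (p : R -> X -> X -> R) : Prop :=
  exists2 C : R, 0 < C & forall (t : R) (g : X -> R) (x y : X),
    0 < t -> g \in Lfun mu +oo%E ->
    (`|kernel_op p t g x - kernel_op p t g y|%:E <=
     (C * (mdist x y `^ kappa / t `^ (kappa / dW)))%:E *
       'N[mu]_+oo[EFin \o g])%E.

(* [eta t] is the density of the [delta]-stable subordinator at time [t] *)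
Definition subordinator_density (delta : R) (eta : R -> R -> R) : Prop :=
  forall t : R, 0 < t ->
  [/\ forall s : R, 0 < s -> 0 <= eta t s,
      forall s : R, 0 < s -> {for s, continuous (eta t)}
    & forall lam : R, 0 < lam ->
        (\int[lebesgue_measure]_(s in `]0%R, +oo[)
            (eta t s * expR (- s * lam))%:E
         = (expR (- t * lam `^ delta))%:E)%E ].

Definition subordinated_kernel (eta : R -> R -> R) (p : R -> X -> X -> R)
    (t : R) (x y : X) : \bar R :=
  (\int[lebesgue_measure]_(s in `]0%R, +oo[) (eta t s * p s x y)%:E)%E.

Definition besov_seminorm (q : R -> X -> X -> \bar R) (p alpha : R)
    (f : X -> R) : \bar R :=
  ereal_sup [set ((t `^ (- alpha))%:E *
      (\int[mu]_y \int[mu]_x ((`|f x - f y| `^ p)%:E * q t x y)) `^ p^-1)%E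
    | t in [set t : R | 0 < t]].

Definition besov (q : R -> X -> X -> \bar R) (p alpha : R) : set (X -> R) :=
  [set f | f \in Lfun mu p%:E /\ (besov_seminorm q p alpha f < +oo)%E].

Definition besov_critical_exponent (q : R -> X -> X -> \bar R) (p : R)
    : \bar R :=
  ereal_sup [set alpha%:E | alpha in
    [set alpha : R | 0 < alpha /\ exists2 f, besov q p alpha f & nonconstant f]].

Definition superlevel (f : X -> R) (t : R) : set X := [set x | t < f x].

End metric_measure_space.

(* Main.v *)
Require Import Defs.
From HB Require Import structures.
From mathcomp Require Import all_boot all_order all_algebra.
From mathcomp Require Import all_classical all_reals all_analysis.
From mathcomp Require Import measurable_realfun lra ring.

Set Implicit Arguments.
Unset Strict Implicit.
Unset Printing Implicit Defensive.
Import Order.TTheory GRing.Theory Num.Theory.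
Import numFieldNormedType.Exports.

Local Open Scope classical_set_scope.
Local Open Scope ring_scope.

(** The seminorm [besov_seminorm mu q 1 1] is a supremum over all times [t], and a
    supremum does not commute with the integral over the levels of [f]. The idea
    is that, up to constants, it is not a supremum at all but a single integral,
    for which the coarea formula is an identity.

    The subordinated kernel is the transition density of a process with
    stable-like jumps. Write [d(x,y)] for the distance and
    [J(x,y) = d(x,y) ^ - (dH + delta dW)] ([jump_kernel]). Off the diagonal,
      [q_t(x,y) <= C t J(x,y)] for all [t] ([subordinated_kernel_le]), and
      [q_t(x,y) >= c t J(x,y)] for [t <= d(x,y) ^ (delta dW) / 8]
        ([subordinated_kernel_ge]).
    The upper bound gives at once that the seminorm of [f] is at most [C] times
    the energy [W(f)], the double integral of [|f x - f y| J(x,y)]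
    ([nonlocal_energy], [besov_seminorm_le]). For the converse, the lower bound
    applies at time [t] to all pairs at distance at least a power of [t], and
    these exhaust all pairs as [t] tends to [0] ([besov_seminorm_ge]).

    Since [|a - b|] is the integral over [s > 0] of the distance of the
    indicators of [s < a] and [s < b] when [a, b >= 0], Tonelli's theorem shows
    that [W(f)] is the integral over [s > 0] of the energy of the superlevel set
    at [s] ([nonlocal_energy_coarea]). Replacing [W] by the seminorm on both sides
    gives the two inequalities ([seminorm_coarea]), and the other two assertions
    follow from the finiteness of the integrals.

    The kernel bounds are scaling arguments. The density of the subordinator is
    known through its Laplace transform [exp (- t lam ^ delta)] only, so the
    sub-Gaussian profile [s ^ (- dH / dW) exp (- c (D / s) ^ (1 / (dW - 1)))],
    where [D = d(x,y) ^ dW], is compared with test functions whose integrals the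
    Laplace transform gives: from above with [1 - exp (- s / D)]
    ([subgaussian_profile_le], [subordinator_onem_exp_le]), from below with a sum
    of four exponentials that is negative near [0] yet has a positive integral
    ([bump_le_subgaussian_profile], [subordinator_bump_ge]). The heat kernel
    bounds hold at every pair of distinct points, not only at almost all pairs,
    since the heat kernel is continuous and [mu] charges open sets
    ([heat_kernel_bounds]). Tonelli's theorem needs the distance to be measurable
    for the product of the Borel sigma-algebras, which follows from separability,
    that is, from the relative compactness of balls ([measurable_mdist]). *)

(** * Power and exponential profiles *)

Section exponential_profiles.
Context {R : realType}.
Implicit Types a b c r s u v w D M : R.

(** The constant comes from the Taylor term of an integer order above [a]; small
    [w] is covered by the summand [1]. *)
Lemma powR_le_expR a c : 0 <= a -> 0 < c ->
  exists2 C, 0 < C & forall w, 0 <= w -> w `^ a <= C * expR (c * w).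
Proof.
move=> a0 c0; pose n := Num.bound a.
have fc0 : 0 < n.+1`!%:R / c ^+ n.+1.
  by rewrite divr_gt0 ?ltr0n ?fact_gt0 ?exprn_gt0.
exists (1 + n.+1`!%:R / c ^+ n.+1); first by rewrite addr_gt0.
move=> w w0; have cw0 : 0 <= c * w by rewrite mulr_ge0// ltW.
rewrite mulrDl mul1r; have [w1|w1] := leP w 1.
  apply: (@le_trans _ _ 1); last first.
    rewrite -[leLHS]addr0 lerD ?(mulr_ge0 (ltW fc0)) ?expR_ge0//.
    by rewrite (le_trans _ (expR_ge1Dx _))// lerDl.
  have [->|wN0] := eqVneq w 0; first by rewrite /powR eqxx; case: eqP.
  by rewrite -(powRr0 w) ger_powR// w1 lt_neqAle eq_sym wN0 w0.
have an : a <= n.+1%:R.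
  by rewrite ltW// (lt_le_trans (archi_boundP a0))// ler_nat.
apply: (@le_trans _ _ (w ^+ n.+1)).
  by rewrite -powR_mulrn// ler_powR// ltW.
have H : (c * w) ^+ n.+1 / n.+1`!%:R <= expR (c * w).
  by rewrite (le_trans _ (expR_ge1Dxn n cw0))// lerDr.
have -> : w ^+ n.+1 =
    n.+1`!%:R / c ^+ n.+1 * ((c * w) ^+ n.+1 / n.+1`!%:R).
  have cN0 : c ^+ n.+1 != 0 by rewrite expf_neq0// gt_eqF.
  have fN0 : n.+1`!%:R != 0 :> R by rewrite pnatr_eq0 -lt0n fact_gt0.
  rewrite exprMn; move: (c ^+ _) (w ^+ _) (_%:R) cN0 fN0 => x y z x0 z0.
  by field; rewrite ?x0 ?z0.
by rewrite ler_wpDl ?expR_ge0// ler_pM2l.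
Qed.

Lemma onem_expRN_ge u : 0 < u -> u / (1 + u) <= 1 - expR (- u).
Proof.
move=> u0; have u1 : 0 < 1 + u by lra.
rewrite lerBrDr -lerBrDl expRN.
have -> : 1 - u / (1 + u) = (1 + u)^-1 by field; lra.
by rewrite lef_pV2 ?posrE ?expR_gt0// expR_ge1Dx.
Qed.

(** At [s] much smaller than [D] the left side decays faster than any power, so
    the linear vanishing of the right side at [0] is affordable; at large [s]
    the right side is bounded below by a constant. *)
Lemma subgaussian_profile_le a b c : 0 < a -> 0 < b -> 0 < c ->
  exists2 C, 0 < C & forall D s, 0 < D -> 0 < s ->
    s `^ (- a) * expR (- c * (D / s) `^ b)
      <= C * (D `^ (- a) * (1 - expR (- (s / D)))).
Proof.
move=> a0 b0 c0.
have [|C C0 HC] := @powR_le_expR ((a + 1) / b) c _ c0.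
  by rewrite divr_ge0// ltW//; lra.
exists (2 * (1 + C)) => [|D s D0 s0]; first by lra.
pose u := s / D; have u0 : 0 < u by rewrite divr_gt0.
have -> : s = D * u by rewrite /u mulrCA mulfV ?mulr1// gt_eqF.
have -> : D / (D * u) = u^-1 by rewrite invfM mulrA mulfV ?mul1r// gt_eqF.
have -> : D * u / D = u by rewrite mulrAC mulfV ?mul1r// gt_eqF.
rewrite (powRM _ (ltW D0) (ltW u0)) -mulrA [leRHS]mulrCA ler_pM2l ?powR_gt0//.
have ge := onem_expRN_ge u0; have ua := powR_ge0 u (- a).
have e1 : expR (- c * u^-1 `^ b) <= 1.
  by rewrite expR_le1 mulNr oppr_le0 mulr_ge0 ?powR_ge0// ltW.
have [u1|u1] := leP 1 u.
  apply: (@le_trans _ _ 1).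
    rewrite -[leRHS]mulr1 ler_pM ?expR_ge0//.
    by rewrite powRN invf_le1 ?powR_gt0// -(powRr0 u) ler_powR// ltW.
  apply: (@le_trans _ _ (2 * (1 + C) * 2^-1)); first by lra.
  rewrite ler_pM2l ?(le_trans _ ge)//; last lra.
  rewrite ler_pdivlMr; lra.
(* with [v = 1 / u], the bound is a power of [v ^ b] against [exp (c v ^ b)] *)
have key : u `^ (- a) * expR (- c * u^-1 `^ b) <= C * u.
  have v0 : 0 <= u^-1 by rewrite invr_ge0 ltW.
  have := HC _ (powR_ge0 u^-1 b).
  rewrite -powRrM (mulrC b) divfK ?gt_eqF// -ler_pdivrMr ?expR_gt0// -expRN -mulNr.
  move=> H; rewrite -ler_pdivrMr// (le_trans _ H)// le_eqVlt; apply/orP; left.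
  rewrite powRD; last by apply/implyP => _; rewrite invr_neq0// gt_eqF.
  rewrite powRr1// -[X in X `^ a](powR_inv1 (ltW u0)) -powRrM mulN1r.
  by apply/eqP; ring.
apply: (le_trans key).
apply: (@le_trans _ _ (2 * (1 + C) * (u / 2))).
  nra.
rewrite ler_pM2l ?(le_trans _ ge)//; last lra.
by rewrite ler_pM2l// lef_pV2 ?posrE; lra.
Qed.

(** Sums of exponentials are the functions whose integrals against the density
    of the subordinator are explicit. This one has the shape
    [g u - 2 / M * g (M u)] with [g u = exp (- u) - exp (- 2 u)]. Since [g u] is
    close to [u] at [0], it is negative there, so that it can lie below a profile
    vanishing to infinite order. On the other hand the integrals of [g] and
    [g (M u)] against the Levy measure [s ^ (- 1 - delta) ds] have ratio
    [M ^ delta], so that its integral is positive once [M ^ (1 - delta) > 2]. *)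
Definition bump M u : R :=
  expR (- u) - expR (- (2 * u))
  - 2 / M * (expR (- (M * u)) - expR (- (2 * M * u))).

Lemma bump_le0 M u : 0 < M -> 0 < u -> M * u <= 4^-1 -> bump M u <= 0.
Proof.
move=> M0 u0 Mu; rewrite /bump subr_le0.
have eE (v : R) : expR (- v) - expR (- (2 * v)) = expR (- v) * (1 - expR (- v)).
  by rewrite mulrBr mulr1 -expRD; congr (_ - expR _); ring.
rewrite -(mulrA 2 M) !eE.
(* the point [u] separates [g u <= u] from [v / 2 <= g v] at [v = M * u] *)
apply: (@le_trans _ _ u).
  rewrite -[leRHS]mul1r ler_pM ?expR_ge0 ?subr_ge0 ?expR_le1 ?oppr_le0 ?(ltW u0)//.
  have := expR_ge1Dx (- u); lra.
have Mu0 : 0 < M * u by rewrite mulr_gt0.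
set v := M * u in Mu Mu0 *.
have {1}-> : u = 2 / M * (v / 2) by rewrite /v; field; rewrite gt_eqF.
rewrite ler_pM2l ?divr_gt0//.
have h1 := expR_ge1Dx (- v); have h2 := onem_expRN_ge Mu0.
apply: (@le_trans _ _ ((1 - v) * (v * (1 - v)))); first nra.
apply: ler_pM => //; [lra|nra|].
rewrite (le_trans _ h2)// ler_pdivlMr; nra.
Qed.

Lemma bump_le_expRN M u : 0 < M -> 0 < u -> bump M u <= expR (- u).
Proof.
move=> M0 u0; rewrite /bump -addrA gerDl -opprD oppr_le0 addr_ge0 ?expR_ge0//.
rewrite mulr_ge0 ?divr_ge0 ?(ltW M0)// subr_ge0 ler_expR lerN2 ler_pM2r//; lra.
Qed.

(** Below [1 / (4 M)] the left side is non-positive; above, the stretched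
    exponential is bounded below and an exponential is below any power. *)
Lemma bump_le_subgaussian_profile a b c M : 0 < a -> 0 < b -> 0 < c -> 0 < M ->
  exists2 C, 0 < C & forall D s, 0 < D -> 0 < s ->
    C * (D `^ (- a) * bump M (s / D))
      <= s `^ (- a) * expR (- c * (D / s) `^ b).
Proof.
move=> a0 b0 c0 M0; have [C C0 HC] := powR_le_expR (ltW a0) (@ltr01 R).
pose e := expR (- c * (4 * M) `^ b).
exists (e / C) => [|D s D0 s0]; first by rewrite divr_gt0 ?expR_gt0.
pose u := s / D; have u0 : 0 < u by rewrite divr_gt0.
have -> : s = D * u by rewrite /u mulrCA mulfV ?mulr1// gt_eqF.
have -> : D / (D * u) = u^-1 by rewrite invfM mulrA mulfV ?mul1r// gt_eqF.
have -> : D * u / D = u by rewrite mulrAC mulfV ?mul1r// gt_eqF.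
rewrite (powRM _ (ltW D0) (ltW u0)) -[leRHS]mulrA mulrCA ler_pM2l ?powR_gt0//.
have [Mu|Mu] := leP (M * u) 4^-1.
  apply: (@le_trans _ _ 0).
    by rewrite pmulr_rle0 ?bump_le0// divr_gt0 ?expR_gt0.
  by rewrite mulr_ge0 ?powR_ge0 ?expR_ge0.
apply: (@le_trans _ _ (e / C * expR (- u))).
  by rewrite ler_pM2l ?bump_le_expRN// divr_gt0 ?expR_gt0.
rewrite mulrAC -mulrA mulrC ler_pM ?expR_ge0//.
- by rewrite divr_ge0 ?expR_ge0// ltW.
- rewrite expRN powRN -invfM lef_pV2 ?posrE ?mulr_gt0 ?expR_gt0 ?powR_gt0//.
  by rewrite mulrC -[in leRHS](mul1r u) HC// ltW.
- rewrite /e ler_expR !mulNr lerN2 ler_pM2l//.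
  rewrite ge0_ler_powR ?nnegrE ?invr_ge0 ?(ltW u0) ?(ltW b0)//.
    by rewrite mulr_ge0// ltW.
  rewrite -[leRHS]invrK lef_pV2 ?posrE// ?invr_gt0 ?mulr_gt0// invfM.
  by rewrite ltW// ltr_pdivrMr// mulrC.
Qed.

Lemma powR_continuous_gt0 r a : 0 < r -> {for r, continuous (@powR R ^~ a)}.
Proof.
move=> r0; apply: differentiable_continuous; apply/derivable1_diffP.
by apply: derivable_powR; rewrite in_itv/= r0.
Qed.

End exponential_profiles.

(** * The stable subordinator, seen through its Laplace transform *)

Section stable_subordinator.
Context {R : realType} (delta : R) (eta : R -> R -> R).
Hypothesis delta01 : 0 < delta < 1.
Hypothesis eta_density : subordinator_density delta eta.
Implicit Types t s lam : R.

Let ge0 t s : 0 < t -> `]0%R, +oo[%classic s -> 0 <= eta t s.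
Proof.
move=> t0; rewrite /= in_itv /= andbT => s0.
by have [+ _ _] := eta_density t0; exact.
Qed.

Lemma measurable_subordinator_density t : 0 < t ->
  measurable_fun (`]0%R, +oo[ : set R) (eta t).
Proof.
move=> t0; have [_ ct _] := eta_density t0.
apply: open_continuous_measurable_fun => //.
by move=> s; rewrite inE/= in_itv/= andbT; exact: ct.
Qed.

Let mexp lam : measurable_fun (`]0%R, +oo[ : set R) (fun s : R => expR (- s * lam)).
Proof.
by apply: measurableT_comp => //; apply: measurable_funM.
Qed.

(** Letting the argument of the Laplace transform tend to [0]. *)
Lemma subordinator_mass_le1 t : 0 < t ->
  (\int[lebesgue_measure]_(s in `]0%R, +oo[) (eta t s)%:E <= 1)%E.
Proof.
move=> t0; have [_ _ lap] := eta_density t0.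
pose g (n : nat) s := (eta t s * expR (- s * n.+1%:R^-1))%:E.
have mg n : measurable_fun (`]0%R, +oo[ : set R) (g n).
  apply/measurable_EFinP/measurable_funM => //.
  exact: measurable_subordinator_density.
have g0 n s : `]0%R, +oo[%classic s -> (0 <= g n s)%E.
  by move=> s0; rewrite lee_fin mulr_ge0 ?expR_ge0// ge0.
have nd s : `]0%R, +oo[%classic s -> {homo g ^~ s : n m / (n <= m)%N >-> (n <= m)%E}.
  move=> s0 n m nm; rewrite lee_fin ler_wpM2l ?ge0// ler_expR !mulNr lerN2.
  move: s0; rewrite /= in_itv/= andbT => s0.
  by rewrite ler_pM2l// lef_pV2 ?posrE// ler_nat ltnS.
have := cvg_monotone_convergence (mu := lebesgue_measure) (measurable_itv _) mg g0 nd.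
set I := (X in _ --> X).
have -> : I = (\int[lebesgue_measure]_(s in `]0%R, +oo[) (eta t s)%:E)%E.
  apply: eq_integral => s _; apply/cvg_lim => //.
  apply: cvg_EFin; first exact: nearW.
  rewrite -[X in _ --> X]mulr1; apply: cvgMr.
  rewrite -[X in _ --> X]expR0 -[X in expR X](mulr0 (- s)).
  apply: continuous_cvg; first exact: continuous_expR.
  by apply: cvgMr; exact: cvg_harmonic.
move=> cI; rewrite -(cvg_lim _ cI)//; apply: lime_le.
  by apply/cvg_ex; eexists; exact: cI.
apply: nearW => n; rewrite lap// lee_fin expR_le1 mulNr oppr_le0.
by rewrite mulr_ge0 ?powR_ge0// ltW.
Qed.

(** The complement [1 - exp (- lam s)] is the only test function needed from
    above: it is linear near [0] and bounded below at infinity, and its integral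
    is the defect [1 - exp (- t lam ^ delta)] of the Laplace transform. *)
Lemma subordinator_onem_exp_le t lam : 0 < t -> 0 < lam ->
  (\int[lebesgue_measure]_(s in `]0%R, +oo[)
     (eta t s * (1 - expR (- s * lam)))%:E <= (t * lam `^ delta)%:E)%E.
Proof.
move=> t0 l0; have [_ _ lap] := eta_density t0.
have m1 := measurable_subordinator_density t0.
have sum : (\int[lebesgue_measure]_(s in `]0%R, +oo[)
     (eta t s * (1 - expR (- s * lam)))%:E
   + \int[lebesgue_measure]_(s in `]0%R, +oo[) (eta t s * expR (- s * lam))%:E
   <= 1)%E.
  rewrite -ge0_integralD//=; first 1 last.
  - move=> s s0; rewrite lee_fin mulr_ge0 ?ge0// subr_ge0 expR_le1.
    by move: s0; rewrite in_itv/= andbT => s0; rewrite mulNr oppr_le0 mulr_ge0// ltW.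
  - apply/measurable_EFinP/measurable_funM => //.
    by apply: measurable_funB => //; exact: mexp.
  - by move=> s s0; rewrite lee_fin mulr_ge0 ?ge0 ?expR_ge0.
  - by apply/measurable_EFinP/measurable_funM => //; exact: mexp.
  under eq_integral do rewrite -EFinD -mulrDr subrK mulr1.
  exact: subordinator_mass_le1.
move: sum; rewrite lap// -leeBrDr// => /le_trans; apply.
by rewrite -EFinB lee_fin lerBlDr -lerBlDl (le_trans _ (expR_ge1Dx _))// mulNr.
Qed.

(** To first order in [t], the integral of [bump M (s lam)] is
    [(2 ^ delta - 1) (1 - 2 M ^ (delta - 1)) t lam ^ delta]. The choice
    [M ^ (1 - delta) = 4] leaves half of [(2 ^ delta - 1) t lam ^ delta], and the
    bound on [t lam ^ delta] keeps the error of the linearization below half of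
    the rest. As [bump] changes sign, its negative terms are moved to the other
    side, where all integrands are non-negative. *)
Lemma subordinator_bump_ge t lam (M K : R) (h : R -> \bar R) :
  0 < t -> 0 < lam -> 0 < M -> M `^ (1 - delta) = 4 ->
  t * lam `^ delta <= 8^-1 -> 0 <= K ->
  measurable_fun (`]0%R, +oo[ : set R) h -> (forall s, 0 < s -> (0 <= h s)%E) ->
  (forall s, 0 < s -> ((K * (eta t s * bump M (s * lam)))%:E <= h s)%E) ->
  ((K * ((2 `^ delta - 1) / 4) * (t * lam `^ delta))%:E
     <= \int[lebesgue_measure]_(s in `]0%R, +oo[) h s)%E.
Proof.
move=> t0 l0 M0 HM tl K0 mh h0 Hh; have [_ _ lap] := eta_density t0.
have /andP[d0 d1] := delta01.
have m1 := measurable_subordinator_density t0.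
pose e (l s : R) := (eta t s * expR (- s * l))%:E.
have e0 l s : `]0%R, +oo[%classic s -> (0 <= e l s)%E.
  by move=> s0; rewrite lee_fin mulr_ge0 ?ge0 ?expR_ge0.
have me l : measurable_fun (`]0%R, +oo[ : set R) (e l).
  by apply/measurable_EFinP/measurable_funM => //; exact: mexp.
have h0' s : `]0%R, +oo[%classic s -> (0 <= h s)%E.
  by rewrite /= in_itv/= andbT; exact: h0.
have c0 : 0 <= 2 / M by rewrite divr_ge0// ltW.
pose c : \bar R := (2 / M)%:E.
have msum l1 l2 : measurable_fun (`]0%R, +oo[ : set R)
    (fun s => e l1 s + c * e l2 s)%E.
  by apply: emeasurable_funD; [exact: me|apply: measurable_funeM; exact: me].
have le_int : (\int[lebesgue_measure]_(s in `]0%R, +oo[)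
    (K%:E * (e lam s + c * e (2 * M * lam)%R s)) <=
    \int[lebesgue_measure]_(s in `]0%R, +oo[)
      (h s + K%:E * (e (2 * lam)%R s + c * e (M * lam)%R s)))%E.
  apply: ge0_le_integral => //=.
  - by move=> s s0; rewrite mule_ge0 ?adde_ge0 ?mule_ge0 ?e0 ?lee_fin.
  - by apply: measurable_funeM; exact: msum.
  - apply: emeasurable_funD => //.
    by apply: measurable_funeM; exact: msum.
  - move=> s; rewrite in_itv/= andbT => s0; apply: (le_trans _ (leeD2r _ (Hh s s0))).
    rewrite /c /e -?(EFinM, EFinD) lee_fin le_eqVlt; apply/orP; left; apply/eqP.
    rewrite /bump (_ : - s * lam = - (s * lam)); last ring.
    rewrite (_ : - s * (2 * M * lam) = - (2 * M * (s * lam))); last ring.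
    rewrite (_ : - s * (2 * lam) = - (2 * (s * lam))); last ring.
    rewrite (_ : - s * (M * lam) = - (M * (s * lam))); last ring.
    ring.
move: le_int.
have split l1 l2 : 0 < l1 -> 0 < l2 ->
    (\int[lebesgue_measure]_(s in `]0%R, +oo[) (K%:E * (e l1 s + c * e l2 s)) =
     (K * (expR (- t * l1 `^ delta) + 2 / M * expR (- t * l2 `^ delta)))%:E)%E.
  move=> l10 l20; rewrite ge0_integralZl_EFin//; last 2 first.
  - by move=> s s0; rewrite adde_ge0 ?mule_ge0 ?e0 ?lee_fin.
  - exact: msum.
  rewrite ge0_integralD//; last 4 first.
  - by move=> s s0; exact: e0.
  - exact: me.
  - by move=> s s0; rewrite mule_ge0 ?e0 ?lee_fin.
  - by apply: measurable_funeM; exact: me.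
  rewrite ge0_integralZl_EFin//; last 2 first.
  - by move=> s s0; exact: e0.
  - exact: me.
  by rewrite /e !lap.
rewrite ge0_integralD//; last 2 first.
- by move=> s s0; rewrite mule_ge0 ?adde_ge0 ?mule_ge0 ?e0 ?lee_fin.
- by apply: measurable_funeM; exact: msum.
rewrite !split ?mulr_gt0// -leeBlDr// -EFinB; apply: le_trans.
rewrite lee_fin -mulrBr -mulrA ler_wpM2l//.
rewrite !powRM ?(ltW l0) ?(ltW M0) ?mulr_ge0 ?(ltW M0)//.
set A := lam `^ delta in tl *; set B := 2 `^ delta; set N := M `^ delta.
have MN : N / M = 4^-1.
  rewrite -HM -(powR_inv1 (ltW M0)) -powRN -powRD; last first.
    by apply/implyP => _; rewrite gt_eqF.
  by congr (_ `^ _); ring.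
have B1 : 1 <= B by rewrite -(powRr0 2) /B ler_powR ?ltW//; lra.
have B2 : B <= 2 by rewrite /B ler1_powR ?ltW//; lra.
have N0 : 0 <= N by exact: powR_ge0.
have A0 : 0 < A by exact: powR_gt0.
set x := t * A in tl *; have x0 : 0 < x by rewrite mulr_gt0.
have first_diff : 3 / 4 * ((B - 1) * x) <= expR (- x) - expR (- (B * x)).
  have -> : - x = - (B * x) + (B - 1) * x by ring.
  rewrite expRD (_ : _ * _ - _ = expR (- (B * x)) * (expR ((B - 1) * x) - 1)); last ring.
  apply: ler_pM => //; [by rewrite mulr_ge0 ?subr_ge0 ?(ltW x0)| |].
  - by rewrite (le_trans _ (expR_ge1Dx _))//; nra.
  - by rewrite lerBrDr addrC expR_ge1Dx.
have second_diff :
    2 / M * (expR (- (N * x)) - expR (- (B * N * x))) <= 2 / 4 * ((B - 1) * x).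
  have -> : 2 / 4 * ((B - 1) * x) = 2 / M * (N * x * (B - 1)).
    by rewrite -MN; ring.
  rewrite ler_pM2l ?divr_gt0//.
  apply: (@le_trans _ _ (1 * (1 - expR (- (N * x * (B - 1)))))).
    rewrite (_ : _ - _ = expR (- (N * x)) * (1 - expR (- (N * x * (B - 1))))).
      rewrite ler_wpM2r ?subr_ge0 ?expR_le1 ?oppr_le0 ?mulr_ge0 ?subr_ge0//; nra.
    by rewrite mulrBr mulr1 -expRD; congr (_ - expR _); ring.
  by rewrite mul1r lerBlDr -lerBlDl (le_trans _ (expR_ge1Dx _))//; nra.
rewrite (_ : - t * A = - x); last by rewrite /x; ring.
rewrite (_ : - t * (B * A) = - (B * x)); last by rewrite /x; ring.
rewrite (_ : - t * (N * A) = - (N * x)); last by rewrite /x; ring.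
rewrite (_ : - t * (B * N * A) = - (B * N * x)); last by rewrite /x; ring.
lra.
Qed.

End stable_subordinator.

(** * Integrals and almost everywhere bounds on a metric measure space *)

Section integral_monotonicity.
Local Open Scope ereal_scope.
Context d (T : measurableType d) (R : realType).
Variable mu : {measure set T -> \bar R}.

(** The integral of a non-negative function is a supremum over the simple
    functions below it, so it is monotone even where measurability is unknown,
    as for the heat kernels and for suprema over all times. *)
Lemma ge0_le_integral_nonmeasurable (D : set T) (f g : T -> \bar R) :
  (forall x, D x -> 0 <= f x) -> (forall x, D x -> f x <= g x) ->
  \int[mu]_(x in D) f x <= \int[mu]_(x in D) g x.
Proof.
move=> f0 fg; rewrite !ge0_integralE//; last first.
  by move=> x Dx; rewrite (le_trans (f0 _ Dx)) ?fg.
apply: le_ereal_sup => _ [h hf <-]; exists h => // x; rewrite (le_trans (hf x))//.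
by apply: lee_restrict.
Qed.

End integral_monotonicity.

Section borel_metric.
Context d (R : realType) (X : borelMetricType d R).
Variable mu : {measure set X -> \bar R}.
Implicit Types x y : X.

Lemma open_measurable_borel (U : set X) : open U -> measurable U.
Proof. by move=> oU; rewrite borel_measurableE; exact: sub_sigma_algebra. Qed.

Lemma ball_open_metric x (r : R) : open (ball x r).
Proof.
rewrite openE => y; rewrite ballEmdist /= => xy.
apply/nbhs_ballP; exists (r - mdist x y); rewrite /= ?subr_gt0// => z.
rewrite ballEmdist /= => yz; rewrite (le_lt_trans (metric_triangle _ y _))//.
by rewrite -ltrBrDl.
Qed.

Lemma mdist_continuous : continuous (fun z : X * X => mdist z.1 z.2).
Proof.
move=> [x y]; apply/cvgrPdist_lt => e e0 /=.
exists (ball x (e / 2), ball y (e / 2)).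
  by split; apply: nbhsx_ballx; rewrite divr_gt0.
move=> [x' y'] [/=]; rewrite !ballEmdist /= => xx' yy'.
have h1 := metric_triangle x x' y; have h2 := metric_triangle x' y' y.
have h3 := metric_triangle x' x y'; have h4 := metric_triangle x y y'.
rewrite (metric_sym y' y) in h2; rewrite (metric_sym x' x) in h3.
rewrite ltr_norml; lra.
Qed.

(** A neighbourhood contains a product of two open sets of positive measure, so
    no null set of the product measure can cover it. *)
Lemma ae_prod_exists_near (Q : X * X -> Prop) (x y : X) (A : set (X * X)) :
  full_support mu -> (\forall z \ae (mu \x mu)%E, Q z) ->
  nbhs (x, y) A -> exists2 z, A z & Q z.
Proof.
move=> supp [N [mN N0 QN]] [[U V]/= [Ux Vy] UV]; apply: contrapT => noQ.
have UN : U° `*` V° `<=` N.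
  move=> z [/interior_subset Uz /interior_subset Vz]; apply: QN => Qz.
  by apply: noQ; exists z => //; exact: UV.
have : (0 < \int[mu]_u (mu V° * (\1_U° u)%:E))%E.
  have mU : measurable U° by apply: open_measurable_borel; exact: open_interior.
  have -> : (\int[mu]_u (mu V° * (\1_U° u)%:E) = mu V° * mu U°)%E.
    rewrite ge0_integralZl//; last by apply/measurable_EFinP.
    by rewrite integral_indic// setIT.
  rewrite mule_gt0// supp//; [|by exists y| |by exists x]; exact: open_interior.
apply/negP; rewrite -leNgt -N0; apply: ge0_le_integral_nonmeasurable.
  by move=> u _; rewrite mule_ge0// lee_fin.
move=> u _; rewrite indicE; have [/set_mem Uu|_] := boolP (u \in (U° : set X)).
  rewrite mule1 le_measure ?inE//.
  - by apply: open_measurable_borel; exact: open_interior.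
  - exact: measurable_xsection.
  - by move=> v Vv; rewrite /xsection/= inE; exact: UN.
by rewrite mule0.
Qed.

(** This upgrades the almost everywhere heat kernel bounds to pointwise ones off
    the diagonal, where both sides are continuous. *)
Lemma ae_prod_continuous_le (Q : X * X -> Prop) (f g : X * X -> R) (z : X * X) :
  full_support mu -> (\forall z \ae (mu \x mu)%E, Q z) ->
  (forall z, Q z -> f z <= g z) ->
  {for z, continuous f} -> {for z, continuous g} -> f z <= g z.
Proof.
move=> supp aeQ fg cf cg; rewrite leNgt; apply/negP => gf.
have /cvgr_gt /(_ 0) : (f w - g w) @[w --> z] --> f z - g z by exact: cvgB.
rewrite subr_gt0 => /(_ gf) nA; case: z => x y in cf cg gf nA *.
have [w /= + /fg] := ae_prod_exists_near supp aeQ nA.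
by rewrite subr_gt0 => /lt_le_trans/[apply]; rewrite ltxx.
Qed.

End borel_metric.

(** * The subordinated heat kernel is comparable to a stable jump kernel *)

Section kernel_bounds.
Context d (R : realType) (X : borelMetricType d R).
Variables (mu : {measure set X -> \bar R}) (p : R -> X -> X -> R).
Variables (dH dW delta : R) (eta : R -> R -> R).
Hypothesis supp : full_support mu.
Hypothesis p_cont : forall (t : R) (x y : X), 0 < t ->
  {for (t, x, y), continuous (fun z : R * X * X => p z.1.1 z.1.2 z.2)}.
Hypothesis HK : heat_kernel_estimates mu dH dW p.
Hypothesis dH0 : 0 < dH.
Hypothesis delta01 : 0 < delta < 1.
Hypothesis eta_density : subordinator_density delta eta.

Let dW2 : 2 <= dW. Proof. by case: HK. Qed.
Let dW0 : 0 < dW. Proof. by apply: lt_le_trans dW2. Qed.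
Let b0 : 0 < (dW - 1)^-1.
Proof. by rewrite invr_gt0 subr_gt0 (lt_le_trans _ dW2)// ltr1n. Qed.

Lemma sub_gaussian_continuous (c c' t : R) (x y : X) : 0 < t -> x != y ->
  {for (x, y), continuous (fun z : X * X => sub_gaussian dH dW c c' t z.1 z.2)}.
Proof.
move=> t0 xy; have r0 : 0 < mdist x y by rewrite mdist_gt0.
have h0 : mdist z.1 z.2 @[z --> (x, y)] --> mdist x y :=
  @mdist_continuous _ _ X (x, y).
have comp (h : R -> R) (f : X * X -> R) l : f z @[z --> (x, y)] --> l ->
    {for l, continuous h} -> h (f z) @[z --> (x, y)] --> h l.
  by move=> fl hl; exact: (@cvg_comp _ _ _ f h _ _ _ fl hl).
have h1 := comp (@powR R ^~ dW) _ _ h0 (powR_continuous_gt0 r0).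
have h2 : mdist z.1 z.2 `^ dW / t @[z --> (x, y)] --> mdist x y `^ dW / t.
  exact: cvgMl.
have h3 := comp (@powR R ^~ (dW - 1)^-1) _ _ h2
  (powR_continuous_gt0 (divr_gt0 (powR_gt0 _ r0) t0)).
have h4 : - c' * (mdist z.1 z.2 `^ dW / t) `^ (dW - 1)^-1 @[z --> (x, y)] -->
    - c' * (mdist x y `^ dW / t) `^ (dW - 1)^-1 by exact: cvgMr.
by apply: cvgMr; exact: (comp expR _ _ h4 (@continuous_expR _ _)).
Qed.

Lemma heat_kernel_bounds : exists c3 c4 c5 c6 : R,
  [/\ 0 < c3, 0 < c4, 0 < c5, 0 < c6
    & forall t x y, 0 < t -> x != y ->
      sub_gaussian dH dW c5 c6 t x y <= p t x y
        <= sub_gaussian dH dW c3 c4 t x y].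
Proof.
have [_ [c3 [c4 [c5 [c6 [c30 c40 c50 c60 bnd]]]]]] := HK.
exists c3, c4, c5, c6; split => // t x y t0 xy.
have pc : {for (x, y), continuous (fun z : X * X => p t z.1 z.2)}.
  have l : (t, z.1, z.2) @[z --> (x, y)] --> (t, x, y).
    apply: (@cvg_pair _ _ _ (nbhs (x, y)) (nbhs (t, x)) (nbhs y) _ _ _
      (fun z : X * X => (t, z.1)) snd _ cvg_snd).
    apply: (@cvg_pair _ _ _ (nbhs (x, y)) (nbhs t) (nbhs x) _ _ _
      (fun=> t) fst _ cvg_fst).
    exact: cvg_cst.
  exact: (@cvg_comp _ _ _ (fun z : X * X => (t, z.1, z.2))
    (fun z : R * X * X => p z.1.1 z.1.2 z.2) _ _ _ l (@p_cont t x y t0)).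
apply/andP; split.
- have := @ae_prod_continuous_le _ _ _ mu _
    (fun z => sub_gaussian dH dW c5 c6 t z.1 z.2) (fun z => p t z.1 z.2) (x, y)
    supp (bnd _ t0).
  by apply => [z /andP[]||]//; exact: sub_gaussian_continuous.
- have := @ae_prod_continuous_le _ _ _ mu _ (fun z => p t z.1 z.2)
    (fun z => sub_gaussian dH dW c3 c4 t z.1 z.2) (x, y) supp (bnd _ t0).
  by apply => [z /andP[]||]//; exact: sub_gaussian_continuous.
Qed.

(** Comparable to the jump kernel of the subordinated process, that is, to the
    limit of [subordinated_kernel eta p t x y / t] as [t] tends to [0]. *)
Definition jump_kernel (x y : X) : R := mdist x y `^ (- (dH + delta * dW)).

Let jump_kernelE x y : x != y ->
  (mdist x y `^ dW) `^ (- (dH / dW)) * ((mdist x y `^ dW)^-1) `^ delta =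
  jump_kernel x y.
Proof.
move=> xy; have r0 : 0 < mdist x y by rewrite mdist_gt0.
rewrite -(powR_inv1 (powR_ge0 _ _)) -!powRrM -powRD; last first.
  by apply/implyP => _; rewrite gt_eqF.
by rewrite /jump_kernel; congr (_ `^ _); field; rewrite gt_eqF.
Qed.

Let sub_gaussianE (c c' t : R) (x y : X) : sub_gaussian dH dW c c' t x y =
  c * (t `^ (- (dH / dW)) * expR (- c' * (mdist x y `^ dW / t) `^ (dW - 1)^-1)).
Proof. by rewrite /sub_gaussian mulNr mulrA. Qed.

Let measurable_p (x y : X) : measurable_fun (`]0%R, +oo[ : set R) (fun s => p s x y).
Proof.
apply: open_continuous_measurable_fun => // s; rewrite inE/= in_itv/= andbT => s0.
have l : (r, x, y) @[r --> s] --> (s, x, y).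
  apply: (@cvg_pair _ _ _ (nbhs s) (nbhs (s, x)) (nbhs y) _ _ _
    (fun r : R => (r, x)) (fun=> y)); last exact: cvg_cst.
  by apply: (@cvg_pair _ _ _ (nbhs s) (nbhs s) (nbhs x) _ _ _ id (fun=> x));
    [exact: cvg_id|exact: cvg_cst].
exact: (@cvg_comp _ _ _ (fun r : R => (r, x, y))
  (fun z : R * X * X => p z.1.1 z.1.2 z.2) _ _ _ l (@p_cont s x y s0)).
Qed.

Let subordinated_density_ge0 t s x y : 0 < t -> 0 < s -> x != y ->
  (0 <= (eta t s * p s x y)%:E)%E.
Proof.
have [c3 [c4 [c5 [c6 [_ _ c50 _ bnd]]]]] := heat_kernel_bounds.
move=> t0 s0 xy; have [eta0 _ _] := eta_density t0.
rewrite lee_fin mulr_ge0 ?eta0//; have /andP[+ _] := bnd _ _ _ s0 xy.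
by apply: le_trans; rewrite sub_gaussianE !mulr_ge0 ?powR_ge0 ?expR_ge0// ltW.
Qed.

Lemma subordinated_kernel_ge0 t x y : 0 < t -> x != y ->
  (0 <= subordinated_kernel eta p t x y)%E.
Proof.
move=> t0 xy; apply: integral_ge0 => s; rewrite /= in_itv/= andbT => s0.
exact: subordinated_density_ge0.
Qed.

(** The subordinator runs on the time scale [D = d(x,y) ^ dW], at which the
    sub-Gaussian profile is below [D ^ (- dH / dW) (1 - exp (- s / D))]. *)
Lemma subordinated_kernel_le : exists2 C, 0 < C & forall t x y, 0 < t -> x != y ->
  (subordinated_kernel eta p t x y <= (C * (t * jump_kernel x y))%:E)%E.
Proof.
have [c3 [c4 [c5 [c6 [c30 c40 c50 c60 bnd]]]]] := heat_kernel_bounds.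
have [C C0 HC] := subgaussian_profile_le (divr_gt0 dH0 dW0) b0 c40.
exists (c3 * C) => [|t x y t0 xy]; first exact: mulr_gt0.
have r0 : 0 < mdist x y by rewrite mdist_gt0.
have [eta0 _ _] := eta_density t0.
pose D := mdist x y `^ dW; have D0 : 0 < D by exact: powR_gt0.
have K0 : 0 <= c3 * C * D `^ (- (dH / dW)).
  by rewrite mulr_ge0 ?powR_ge0// ltW// mulr_gt0.
apply: (@le_trans _ _ (\int[lebesgue_measure]_(s in `]0%R, +oo[)
    ((c3 * C * D `^ (- (dH / dW)))%:E
      * (eta t s * (1 - expR (- s * D^-1)))%:E))%E).
  apply: ge0_le_integral_nonmeasurable => s; rewrite /= in_itv/= andbT => s0.
    exact: subordinated_density_ge0.
  rewrite -EFinM lee_fin [leRHS]mulrCA ler_wpM2l ?eta0//.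
  have /andP[_ +] := bnd _ _ _ s0 xy; move=> /le_trans; apply.
  rewrite sub_gaussianE -(mulrA (c3 * C)) -(mulrA c3) ler_pM2l//.
  by rewrite [- s * _]mulNr; exact: (HC D s D0 s0).
rewrite ge0_integralZl_EFin//; last 2 first.
- move=> s; rewrite /= in_itv/= andbT => s0.
  rewrite lee_fin mulr_ge0 ?eta0// subr_ge0 expR_le1 mulNr oppr_le0.
  by rewrite mulr_ge0 ?invr_ge0// ltW.
- apply/measurable_EFinP/measurable_funM.
    exact: (measurable_subordinator_density eta_density t0).
  apply: measurable_funB => //; apply: measurableT_comp => //.
  exact: measurable_funM.
have D1 : 0 < D^-1 by rewrite invr_gt0.
apply: le_trans.
  apply: lee_wpmul2l; first by rewrite lee_fin.
  exact: (subordinator_onem_exp_le eta_density t0 D1).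
rewrite -EFinM lee_fin -(jump_kernelE xy) -/D le_eqVlt.
by apply/orP; left; apply/eqP; ring.
Qed.

(** The restriction on [t] keeps the process at scales below the distance of the
    two points, where one large jump is the likeliest way to connect them. *)
Lemma subordinated_kernel_ge : exists2 c, 0 < c & forall t x y, 0 < t -> x != y ->
  t <= mdist x y `^ (delta * dW) / 8 ->
  ((c * (t * jump_kernel x y))%:E <= subordinated_kernel eta p t x y)%E.
Proof.
have /andP[d0 d1] := delta01.
have [c3 [c4 [c5 [c6 [c30 c40 c50 c60 bnd]]]]] := heat_kernel_bounds.
pose M : R := 4 `^ (1 - delta)^-1; have M0 : 0 < M by exact: powR_gt0.
have HM : M `^ (1 - delta) = 4.
  by rewrite /M -powRrM mulVf ?powRr1//; lra.
have [C C0 HC] := bump_le_subgaussian_profile (divr_gt0 dH0 dW0) b0 c60 M0.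
have B1 : 0 < (2 : R) `^ delta - 1.
  rewrite subr_gt0 -[ltLHS](powRr0 2) /powR gt_eqF// ltr_expR mul0r.
  by rewrite mulr_gt0// ln_gt0//; lra.
exists (c5 * C * ((2 `^ delta - 1) / 4)) => [|t x y t0 xy tr].
  by rewrite !mulr_gt0.
have r0 : 0 < mdist x y by rewrite mdist_gt0.
have [eta0 _ _] := eta_density t0.
pose D := mdist x y `^ dW; have D0 : 0 < D by exact: powR_gt0.
have D1 : 0 < D^-1 by rewrite invr_gt0.
pose K := c5 * C * D `^ (- (dH / dW)).
have K0 : 0 <= K by rewrite mulr_ge0 ?powR_ge0// ltW// mulr_gt0.
have -> : c5 * C * ((2 `^ delta - 1) / 4) * (t * jump_kernel x y) =
    K * ((2 `^ delta - 1) / 4) * (t * D^-1 `^ delta).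
  by rewrite -(jump_kernelE xy) /K -/D; ring.
apply: (subordinator_bump_ge delta01 eta_density t0 D1 M0 HM) => //.
- rewrite -(ler_pM2r (_ : 0 < D `^ delta)) ?powR_gt0// -mulrA.
  rewrite -(powRM _ (ltW D1) (ltW D0)).
  by rewrite mulVf ?gt_eqF// powR1 mulr1 [leRHS]mulrC /D -powRrM (mulrC dW).
- apply/measurable_EFinP/measurable_funM; last exact: measurable_p.
  exact: (measurable_subordinator_density eta_density t0).
- by move=> s s0; exact: subordinated_density_ge0.
- move=> s s0; rewrite lee_fin mulrCA ler_wpM2l ?eta0//.
  have /andP[+ _] := bnd _ _ _ s0 xy; apply: le_trans.
  rewrite sub_gaussianE /K -(mulrA (c5 * C)) -(mulrA c5) ler_pM2l//.
  exact: (HC D s D0 s0).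
Qed.

End kernel_bounds.

(** * Measurability of the distance and sigma-finiteness *)

Section product_measurability.
Context d (R : realType) (X : borelMetricType d R).
Implicit Types x y : X.

Lemma finite_nets (x0 : X) : balls_relatively_compact X ->
  exists D : nat -> seq X, forall n x, ball x0 n%:R x ->
    exists2 s, s \in D n & mdist s x < n.+1%:R^-1.
Proof.
(* the open cover characterization of compactness is that of pointed spaces *)
move=> cX; pose Xp : ptopologicalType := HB.pack (X : Type) X (isPointed.Build X x0).
suff /choice[D HD] : forall n : nat, exists D : seq X, forall x, ball x0 n%:R x ->
    exists2 s, s \in D & mdist s x < n.+1%:R^-1 by exists D.
move=> n; have /= : @compact Xp (closure (ball x0 n%:R)) by exact: cX.
rewrite compact_cover => /(_ X [set: X] (fun s => ball s n.+1%:R^-1)).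
case=> [s _|x _|D _ HD]; first exact: ball_open_metric.
  by exists x => //; apply: ballxx; rewrite invr_gt0.
exists (finmap.enum_fset D) => x /subset_closure /HD[s /= sD].
rewrite ballEmdist => sx.
by exists s.
Qed.

Lemma measurable_mdistl (s : X) : measurable_fun [set: X] (mdist s).
Proof.
apply: (measurability _ (RGenInftyO.measurableE R)) => // _ [_ [r ->] <-].
rewrite setTI (_ : _ @^-1` _ = ball s r); last first.
  by rewrite ballEmdist; apply/seteqP; split => x /=; rewrite in_itv.
by apply: open_measurable_borel; exact: ball_open_metric.
Qed.

(** The distance is an infimum of sums of distances to the points of countably
    many finite nets; this is where separability is needed, as the product of
    Borel sigma-algebras may otherwise miss the diagonal. *)
Lemma measurable_mdist : balls_relatively_compact X ->
  measurable_fun [set: X * X] (fun z : X * X => mdist z.1 z.2).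
Proof.
move=> cX; have [[x0 _]|X0] := pselect (exists x : X, True); last first.
  move=> _ B mB; rewrite (_ : _ `&` _ = set0)//.
  by apply/seteqP; split => // -[x y]; case: X0; exists x.
have [D HD] := finite_nets x0 cX.
apply: (measurability _ (RGenInftyO.measurableE R)) => // _ [_ [r ->] <-].
pose g s (z : X * X) := mdist s z.1 + mdist s z.2.
have -> : [set: X * X] `&` (fun z : X * X => mdist z.1 z.2) @^-1` `]-oo, r[ =
    \bigcup_n \bigcup_(s in [set` D n]) (g s @^-1` `]-oo, r[).
  apply/seteqP; split => -[x y] /=; rewrite in_itv/=.
    move=> [_ xyr]; have [n nr] : exists n : nat, mdist x0 x < n%:R /\
        n.+1%:R^-1 < (r - mdist x y) / 2.
      have e0 : 0 < (r - mdist x y) / 2 by rewrite divr_gt0// subr_gt0.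
      exists (maxn (Num.bound (mdist x0 x)) (Num.bound ((r - mdist x y) / 2)^-1)).
      split.
        by rewrite (lt_le_trans (archi_boundP _)) ?mdist_ge0// ler_nat leq_maxl.
      rewrite invf_plt ?posrE// (lt_le_trans (archi_boundP _))//.
        by rewrite invr_ge0 ltW.
      by rewrite ler_nat leqW// leq_maxr.
    case: nr => n1 n2; have [|s sD sx] := HD n x; first by rewrite ballEmdist.
    exists n => //; exists s => //=; rewrite in_itv/= /g /=.
    have := metric_triangle s x y; have := lt_trans sx n2; lra.
  move=> [n _ [s _]] /=; rewrite in_itv/= /g/= => H; split => //.
  have := metric_triangle x s y; rewrite (metric_sym x s); move: H; lra.
apply: bigcup_measurable => n _; apply: fin_bigcup_measurable => // s _.
rewrite -[X in measurable X]setTI.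
have : measurable_fun [set: X * X] (g s).
  by apply: measurable_funD; apply: measurableT_comp => //; exact: measurable_mdistl.
by apply.
Qed.

Lemma measurable_mdist_powR (a : R) : balls_relatively_compact X ->
  measurable_fun [set: X * X] (fun z : X * X => mdist z.1 z.2 `^ a).
Proof.
move=> /measurable_mdist md.
exact: (@measurableT_comp _ _ _ _ _ _ (@powR R ^~ a) _ _ (measurable_powR a) md).
Qed.

Lemma ahlfors_sigma_finite (mu : {measure set X -> \bar R}) (dH : R) :
  ahlfors_regular mu dH -> sigma_finite [set: X] mu.
Proof.
move=> [_ [c1 [c2 [_ _ bnd]]]].
have [[x0 _]|X0] := pselect (exists x : X, True); last first.
  exists (fun=> set0); last by move=> n; rewrite measure0.
  by apply/seteqP; split => // x; case: X0; exists x.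
exists (fun n => ball x0 n%:R) => [|n].
  apply/seteqP; split => // x _; exists (Num.bound (mdist x0 x)) => //.
  by rewrite ballEmdist /= archi_boundP// mdist_ge0.
split; first by apply: open_measurable_borel; exact: ball_open_metric.
have /andP[_ /le_lt_trans] := bnd x0 n%:R (ler0n _ _); apply.
exact: ltry.
Qed.

End product_measurability.

(** * The nonlocal energy and its coarea formula *)

(** The two indicators differ exactly for the levels [s] between [a] and [b]. *)
Lemma layer_cake_dist {R : realType} (a b c : R) : 0 <= a -> 0 <= b -> 0 <= c ->
  (\int[lebesgue_measure]_(s in `]0%R, +oo[)
     (`|(s < a)%R%:R - (s < b)%R%:R| * c)%:E = (`|a - b| * c)%:E)%E.
Proof.
wlog ab : a b / a <= b.
  move=> H a0 b0 c0; have [ab|/ltW ba] := leP a b; first exact: H.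
  by rewrite distrC -H//; apply: eq_integral => s _; rewrite distrC.
move=> a0 b0 c0.
have abE : `|a - b|%:E = lebesgue_measure (`[a, b[ : set R).
  rewrite lebesgue_measure_itv/= lte_fin distrC ger0_norm ?subr_ge0// EFinB.
  have [//|ba] := ltP a b; have -> : a = b by apply/eqP; rewrite eq_le ab.
  by rewrite -EFinB subrr.
have mI : measurable (`[a, b[ : set R) by exact: measurable_itv.
transitivity (\int[lebesgue_measure]_(s in `]0%R, +oo[)
    (c%:E * (\1_(`[a, b[ : set R) s)%:E))%E.
  apply: eq_integral => s _; rewrite EFinM muleC; congr (_ * _%:E)%E.
  rewrite indicE mem_setE in_itv/=; have [sa|sa] := ltP s a => /=.
    by rewrite (lt_le_trans sa ab) subrr normr0.
  by rewrite sub0r normrN; case: (s < b); rewrite ?normr1 ?normr0.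
rewrite ge0_integralZl_EFin//; last by apply/measurable_EFinP.
rewrite integral_itv_obnd_cbnd; last by apply/measurable_EFinP.
rewrite integral_indic// setIidl => [|s].
  by rewrite EFinM abE muleC.
by rewrite /= !in_itv/= andbT => /andP[+ _]; exact: le_trans.
Qed.

Lemma measurable_superlevel d (R : realType) (X : borelMetricType d R)
    (f : X -> R) (s : R) : measurable_fun [set: X] f ->
  measurable (superlevel f s).
Proof.
move=> mf; rewrite -[superlevel f s]setTI.
have -> : superlevel f s = f @^-1` `]s, +oo[.
  by apply/seteqP; split => x; rewrite /= in_itv/= andbT.
by apply: mf.
Qed.

(** For [J = jump_kernel dH dW delta] this is the Gagliardo seminorm of order
    [delta dW] in [L^1]. *)
Definition nonlocal_energy {d} {R : realType} {X : borelMetricType d R}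
    (mu : set X -> \bar R) (J : X -> X -> R) (f : X -> R) : \bar R :=
  (\int[mu]_y \int[mu]_x (`|f x - f y| * J x y)%:E)%E.

Section nonlocal_energy.
Context d (R : realType) (X : borelMetricType d R).
Variables (mu : {sigma_finite_measure set X -> \bar R}) (J : X -> X -> R).
Hypothesis J0 : forall x y, 0 <= J x y.
Hypothesis mJ : measurable_fun [set: X * X] (fun z : X * X => J z.1 z.2).
Implicit Types f g : X -> R.
Local Notation nonlocal_energy := (nonlocal_energy mu J).

(** The outer variable of the energy comes first in the pair. *)
Definition energy_density f (z : X * X) : \bar R :=
  (`|f z.2 - f z.1| * J z.2 z.1)%:E.

Lemma energy_density_ge0 f z : (0 <= energy_density f z)%E.
Proof. by rewrite lee_fin mulr_ge0. Qed.

Let mJ' : measurable_fun [set: X * X] (fun z : X * X => J z.2 z.1).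
Proof.
have /= := @measurableT_comp _ _ _ _ _ _ _ _ (fun z : X * X => (z.2, z.1)) mJ.
by apply; exact: measurable_fun_pair.
Qed.

Lemma measurable_energy_density f : measurable_fun [set: X] f ->
  measurable_fun [set: X * X] (energy_density f).
Proof.
move=> mf; apply/measurable_EFinP/measurable_funM => //.
apply: measurableT_comp => //.
by apply: measurable_funB; apply: measurableT_comp.
Qed.

Lemma nonlocal_energy_prod f : measurable_fun [set: X] f ->
  nonlocal_energy f = (\int[mu \x mu]_z energy_density f z)%E.
Proof.
move=> mf; rewrite (@fubini_tonelli1 _ _ _ _ _ mu mu (energy_density f))//.
  exact: measurable_energy_density.
exact: energy_density_ge0.
Qed.

Lemma ae_eq_nonlocal_energy f g :
  measurable_fun [set: X] f -> measurable_fun [set: X] g ->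
  (\forall x \ae mu, f x = g x) -> nonlocal_energy f = nonlocal_energy g.
Proof.
move=> mf mg fg; apply: ge0_ae_eq_integral => //.
- exact: (measurable_fun_fubini_tonelli_F (m2 := mu) (energy_density f)
    (measurable_energy_density mf) (energy_density_ge0 f)).
- exact: (measurable_fun_fubini_tonelli_F (m2 := mu) (energy_density g)
    (measurable_energy_density mg) (energy_density_ge0 g)).
- by move=> y _; apply: integral_ge0 => x _; rewrite lee_fin mulr_ge0.
- by move=> y _; apply: integral_ge0 => x _; rewrite lee_fin mulr_ge0.
have mdens (h : X -> R) (y : X) : measurable_fun [set: X] h ->
    measurable_fun [set: X] (fun x => (`|h x - h y| * J x y)%:E).
  move=> mh.
  exact: (measurableT_comp (measurable_energy_density mh) (pair1_measurable y)).
apply: filterS (fg) => y fgy _; apply: ge0_ae_eq_integral => //.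
- exact: mdens.
- exact: mdens.
- by move=> x _; rewrite lee_fin mulr_ge0.
- by move=> x _; rewrite lee_fin mulr_ge0.
by apply: filterS (fg) => x fgx _; rewrite /= fgx fgy.
Qed.

Section coarea.
Variable f : X -> R.
Hypothesis mf : measurable_fun [set: X] f.

Let level_density (w : R * X * X) := (`|\1_(superlevel f w.1.1) w.2
  - \1_(superlevel f w.1.1) w.1.2 : R| * J w.2 w.1.2)%:E.

Let level_density_ge0 w : (0 <= level_density w)%E.
Proof. by rewrite lee_fin mulr_ge0. Qed.

Let mlevel_density : measurable_fun [set: R * X * X] level_density.
Proof.
have mlevel (h : R * X * X -> X) : measurable_fun [set: R * X * X] h ->
    measurable_fun [set: R * X * X] (fun w => \1_(superlevel f w.1.1) (h w) : R).
  move=> mh; pose B := [set w | w.1.1 < f (h w)].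
  have mB : measurable B.
    have -> : B = [set: R * X * X] `&` (fun w => f (h w) - w.1.1) @^-1` `]0, +oo[.
      by rewrite setTI; apply/seteqP; split => w; rewrite /B/= in_itv/= andbT subr_gt0.
    have mg : measurable_fun [set: R * X * X] (fun w => f (h w) - w.1.1).
      by apply: measurable_funB => //; apply: measurableT_comp.
    by apply: mg.
  rewrite (_ : (fun w => _) = \1_B); first exact: measurable_indic.
  by apply/funext => w; rewrite !indicE.
have m12 : measurable_fun [set: R * X * X] (fun w => w.1.2) by apply: measurableT_comp.
apply/measurable_EFinP/measurable_funM.
  by apply: measurableT_comp => //; apply: measurable_funB; apply: mlevel.
have /= := @measurableT_comp _ _ _ _ _ _ _ _ (fun w : R * X * X => (w.2, w.1.2)) mJ.
by apply; exact: measurable_fun_pair.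
Qed.

Let energyE s : nonlocal_energy (\1_(superlevel f s)) =
  (\int[mu]_y fubini_F mu level_density (s, y))%E.
Proof. by []. Qed.

Let minner : measurable_fun [set: R * X] (fubini_F mu level_density).
Proof. exact: measurable_fun_fubini_tonelli_F. Qed.

Let inner_ge0 v : (0 <= fubini_F mu level_density v)%E.
Proof. exact: integral_ge0. Qed.

Lemma measurable_nonlocal_energy_superlevel :
  measurable_fun [set: R] (fun s => nonlocal_energy (\1_(superlevel f s))).
Proof.
rewrite (_ : (fun s => _) = fubini_F mu (fubini_F mu level_density)).
  exact: measurable_fun_fubini_tonelli_F.
by apply/funext => s; rewrite energyE.
Qed.

(** Tonelli's theorem, twice, brings the integral over the levels inside; the
    levels are restricted to the positive ones by an indicator, so that the
    integrals are over product spaces. *)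
Lemma nonlocal_energy_coarea : (forall x, 0 <= f x) ->
  (nonlocal_energy f = \int[lebesgue_measure]_(s in `]0%R, +oo[)
     nonlocal_energy (\1_(superlevel f s)))%E.
Proof.
move=> f0; pose pos : set R := `]0%R, +oo[%classic.
have mpos : measurable pos by exact: measurable_itv.
pose ind (s : R) : \bar R := (\1_pos s)%:E.
have mind : measurable_fun [set: R] ind.
  by apply/measurable_EFinP; exact: measurable_indic.
have ind_ge0 s : (0 <= ind s)%E by rewrite lee_fin.
pose g (v : R * X) := (ind v.1 * fubini_F mu level_density v)%E.
have mg : measurable_fun [set: R * X] g.
  by apply: emeasurable_funM => //; exact: (measurableT_comp mind measurable_fst).
have g0 v : (0 <= g v)%E by rewrite mule_ge0.
transitivity (\int[lebesgue_measure]_s \int[mu]_y g (s, y))%E; last first.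
  rewrite [RHS]integral_mkcond; apply: eq_integral => s _.
  rewrite patchE energyE /g /ind/= indicE.
  case: (s \in _); last by rewrite integral0_eq// => z _; rewrite mul0e.
  by apply: eq_integral => z _; rewrite mul1e.
transitivity (\int[mu]_y \int[lebesgue_measure]_s g (s, y))%E; last first.
  exact/esym/(@fubini_tonelli _ _ _ _ _ lebesgue_measure mu g mg g0).
apply: eq_integral => y _.
pose h (v : R * X) := (ind v.1 * level_density (v.1, y, v.2))%E.
have mh : measurable_fun [set: R * X] h.
  apply: emeasurable_funM; first exact: (measurableT_comp mind measurable_fst).
  have mp : measurable_fun [set: R * X] (fun v : R * X => (v.1, y, v.2)).
    by apply: measurable_fun_pair => //; exact: measurable_fun_pair.
  exact: (measurableT_comp mlevel_density mp).
have h0 v : (0 <= h v)%E by rewrite mule_ge0.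
transitivity (\int[lebesgue_measure]_s \int[mu]_x h (s, x))%E; last first.
  apply: eq_integral => s _; rewrite /g /h /fubini_F/=.
  rewrite ge0_integralZl//.
  have mp : measurable_fun [set: X] (fun x : X => (s, y, x)).
    exact: measurable_fun_pair.
  exact: (measurableT_comp mlevel_density mp).
transitivity (\int[mu]_x \int[lebesgue_measure]_s h (s, x))%E; last first.
  exact/esym/(@fubini_tonelli _ _ _ _ _ lebesgue_measure mu h mh h0).
apply: eq_integral => x _.
rewrite -(layer_cake_dist (f0 x) (f0 y) (J0 x y)) [LHS]integral_mkcond.
have lev s z : (z \in superlevel f s) = (s < f z).
  by apply/idP/idP => [/set_mem//|sz]; exact/mem_set.
apply: eq_integral => s _; rewrite patchE /h /ind/= indicE.
case: (s \in _); last by rewrite mul0e.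
by rewrite mul1e /level_density/= !indicE !lev.
Qed.

End coarea.

End nonlocal_energy.

Section nonlocal_energy_kernels.
Context d (R : realType) (X : borelMetricType d R).
Variable mu : {sigma_finite_measure set X -> \bar R}.
Implicit Types (f : X -> R) (J : X -> X -> R).

Lemma nonlocal_energyZ f J k : measurable_fun [set: X] f ->
  (forall x y, 0 <= J x y) ->
  measurable_fun [set: X * X] (fun z : X * X => J z.1 z.2) -> 0 <= k ->
  (nonlocal_energy mu (fun x y => k * J x y)%R f = k%:E * nonlocal_energy mu J f)%E.
Proof.
move=> mf J0 mJ k0; rewrite !nonlocal_energy_prod//.
- rewrite -ge0_integralZl_EFin//.
  + by apply: eq_integral => z _; rewrite -EFinM mulrCA.
  + by move=> z _; rewrite lee_fin mulr_ge0.
  + exact: measurable_energy_density.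
- by move=> x y; rewrite mulr_ge0.
- exact: measurable_funM.
Qed.

(** Monotone convergence in the kernel. Convergence off the diagonal suffices,
    because the increments of [f] vanish on it. *)
Lemma nonlocal_energy_le_lim (J_ : nat -> X -> X -> R) J f M :
  measurable_fun [set: X] f ->
  (forall n x y, 0 <= J_ n x y) ->
  (forall n, measurable_fun [set: X * X] (fun z : X * X => J_ n z.1 z.2)) ->
  (forall x y, {homo (fun n => J_ n x y) : n m / (n <= m)%N >-> n <= m}) ->
  (forall x y, 0 <= J x y) ->
  measurable_fun [set: X * X] (fun z : X * X => J z.1 z.2) ->
  (forall x y, x != y -> \forall n \near \oo, J_ n x y = J x y) ->
  (forall n, (nonlocal_energy mu (J_ n) f <= M)%E) ->
  (nonlocal_energy mu J f <= M)%E.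
Proof.
move=> mf J_0 mJ_ ndJ J0 mJ J_J JM.
pose g n := energy_density (J_ n) f.
have mg n : measurable_fun [set: X * X] (g n).
  exact: measurable_energy_density.
have g0 n z : [set: X * X] z -> (0 <= g n z)%E.
  by move=> _; exact: energy_density_ge0.
have nd z : [set: X * X] z -> {homo g ^~ z : n m / (n <= m)%N >-> (n <= m)%E}.
  by move=> _ n m nm; rewrite lee_fin ler_wpM2l// ndJ.
have := cvg_monotone_convergence (mu := (mu \x mu)%E) measurableT mg g0 nd.
set I := (X in _ --> X) => cI.
have <- : I = nonlocal_energy mu J f.
  rewrite nonlocal_energy_prod//; apply: eq_integral => -[y x] _.
  apply/cvg_lim => //; apply: cvg_near_cst.
  have [->|xy] := eqVneq x y.
    by apply: nearW => n; rewrite /g /energy_density/= subrr normr0 !mul0r.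
  by apply: filterS (J_J x y xy) => n; rewrite /g /energy_density/= => ->.
rewrite -(cvg_lim _ cI)//; apply: lime_le; first by apply/cvg_ex; eexists; exact: cI.
apply: nearW => n; rewrite (le_trans _ (JM n))// nonlocal_energy_prod//.
Qed.

End nonlocal_energy_kernels.

(** * Comparison of the seminorm with the nonlocal energy *)

Section besov_comparison.
Context d (R : realType) (X : borelMetricType d R).
Implicit Types (f : X -> R) (q : R -> X -> X -> \bar R) (J rho : X -> X -> R).

Lemma le_double_integral (mu : {measure set X -> \bar R}) (F G : X -> X -> \bar R) :
  (forall x y, 0 <= F x y)%E -> (forall x y, F x y <= G x y)%E ->
  (\int[mu]_y \int[mu]_x F x y <= \int[mu]_y \int[mu]_x G x y)%E.
Proof.
move=> F0 FG; apply: ge0_le_integral_nonmeasurable => y _.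
  exact: integral_ge0.
exact: ge0_le_integral_nonmeasurable.
Qed.

Lemma besov_seminorm11E (mu : {measure set X -> \bar R}) q f :
  (forall t x y, 0 < t -> x != y -> (0 <= q t x y)%E) ->
  besov_seminorm mu q 1 1 f = ereal_sup
    [set (t^-1%:E * \int[mu]_y \int[mu]_x (`|f x - f y|%:E * q t x y))%E
      | t in [set t : R | 0 < t]].
Proof.
move=> q0; congr (ereal_sup _); apply: eq_imagel => t /= t0.
rewrite invr1 powR_inv1 ?ltW//.
under eq_integral do under eq_integral do rewrite powRr1//.
rewrite poweRe1//; apply: integral_ge0 => y _; apply: integral_ge0 => x _.
have [->|xy] := eqVneq x y; first by rewrite subrr normr0 mul0e.
by rewrite mule_ge0// q0.
Qed.

Variables (mu : {sigma_finite_measure set X -> \bar R}).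
Variables (q : R -> X -> X -> \bar R) (J : X -> X -> R).
Hypothesis q0 : forall t x y, 0 < t -> x != y -> (0 <= q t x y)%E.
Hypothesis J0 : forall x y, 0 <= J x y.
Hypothesis mJ : measurable_fun [set: X * X] (fun z : X * X => J z.1 z.2).

Lemma besov_seminorm_le (C : R) f : 0 <= C ->
  (forall t x y, 0 < t -> x != y -> (q t x y <= (C * (t * J x y))%:E)%E) ->
  measurable_fun [set: X] f ->
  (besov_seminorm mu q 1 1 f <= C%:E * nonlocal_energy mu J f)%E.
Proof.
move=> C0 qC mf; rewrite besov_seminorm11E//; apply: ge_ereal_sup => _ [t /= t0 <-].
have Ct0 : 0 <= C * t by rewrite mulr_ge0// ltW.
pose M : \bar R := (t^-1%:E * nonlocal_energy mu (fun x y => C * t * J x y)%R f)%E.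
apply: (@le_trans _ _ M); rewrite /M.
  apply: lee_wpmul2l; first by rewrite lee_fin invr_ge0 ltW.
  apply: le_double_integral => x y; have [->|xy] := eqVneq x y.
  - by rewrite subrr normr0 mul0e.
  - by rewrite mule_ge0// q0.
  - by rewrite subrr normr0 mul0e mul0r.
  - by rewrite EFinM lee_wpmul2l// -mulrA qC.
rewrite nonlocal_energyZ// muleA -EFinM mulrCA mulVf ?mulr1//.
by rewrite gt_eqF.
Qed.

(** Small times see only the pairs at a distance bounded below; letting the time
    tend to [0] recovers all pairs by monotone convergence. Thus arbitrarily
    small times already exhaust the supremum, up to a constant. *)
Lemma besov_seminorm_ge (c : R) rho f : 0 < c ->
  (forall x y, x != y -> 0 < rho x y) ->
  measurable_fun [set: X * X] (fun z : X * X => rho z.1 z.2) ->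
  (forall t x y, 0 < t -> x != y -> t <= rho x y ->
     ((c * (t * J x y))%:E <= q t x y)%E) ->
  measurable_fun [set: X] f ->
  (c%:E * nonlocal_energy mu J f <= besov_seminorm mu q 1 1 f)%E.
Proof.
move=> c0 rho0 mrho qc mf.
pose J_ (n : nat) x y := c * J x y * (n.+1%:R^-1 <= rho x y)%R%:R.
have J_0 n x y : 0 <= J_ n x y by rewrite !mulr_ge0// ltW.
have mJ_ n : measurable_fun [set: X * X] (fun z : X * X => J_ n z.1 z.2).
  apply: measurable_funM; first exact: measurable_funM.
  pose B := [set z : X * X | n.+1%:R^-1 <= rho z.1 z.2].
  have mB : measurable B.
    have -> : B = [set: X * X] `&` (fun z => rho z.1 z.2) @^-1` `[n.+1%:R^-1, +oo[.
      by rewrite setTI; apply/seteqP; split => z; rewrite /B/= in_itv/= andbT.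
    exact: mrho.
  rewrite (_ : (fun z => _) = \1_B); first exact: measurable_indic.
  by apply/funext => z; rewrite indicE mem_setE.
rewrite -nonlocal_energyZ ?(ltW c0)//.
apply: (nonlocal_energy_le_lim mf J_0 mJ_).
- move=> x y n m nm; rewrite ler_wpM2l ?mulr_ge0 ?(ltW c0)// ler_nat.
  have [nr|_] := leP n.+1%:R^-1 (rho x y); last by [].
  by rewrite (le_trans _ nr)// lef_pV2 ?posrE// ler_nat ltnS.
- by move=> x y; rewrite mulr_ge0// ltW.
- exact: measurable_funM.
- move=> x y /rho0 r0; have [n nr] := @ltr_add_invr R 0 (rho x y) r0.
  exists n => // m /= nm; rewrite add0r in nr.
  have mr : m.+1%:R^-1 <= rho x y.
    by apply: (le_trans _ (ltW nr)); rewrite lef_pV2 ?posrE// ler_nat ltnS.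
  by rewrite /J_ mr mulr1.
- move=> n; set t : R := n.+1%:R^-1; have t0 : 0 < t by rewrite invr_gt0.
  rewrite besov_seminorm11E//; apply: le_trans (ereal_sup_ubound _); last first.
    by exists t; [exact: t0|reflexivity].
  set W := nonlocal_energy mu (J_ n) f.
  have -> : W = (t^-1%:E * (t%:E * W))%E.
    by rewrite muleA -EFinM mulVf ?gt_eqF// mul1e.
  apply: lee_wpmul2l; first by rewrite lee_fin invr_ge0 ltW.
  rewrite /W -nonlocal_energyZ ?(ltW t0)//.
  apply: le_double_integral => x y; first by rewrite lee_fin !mulr_ge0// ltW.
  have [->|xy] := eqVneq x y; first by rewrite subrr normr0 mul0e mul0r.
  rewrite EFinM lee_wpmul2l// /J_.
  have [tr|_] := leP t (rho x y); last by rewrite !mulr0 q0.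
  by rewrite mulr1 mulrCA qc.
Qed.

End besov_comparison.

(** * Coarea inequalities for functionals comparable to the energy *)

Section coarea_comparison.
Context d (R : realType) (X : borelMetricType d R).
Variables (mu : {sigma_finite_measure set X -> \bar R}) (J : X -> X -> R).
Hypothesis J0 : forall x y, 0 <= J x y.
Hypothesis mJ : measurable_fun [set: X * X] (fun z : X * X => J z.1 z.2).
Variables (S : (X -> R) -> \bar R) (c C : R).
Hypothesis c0 : 0 < c.
Hypothesis C0 : 0 < C.
Hypothesis S_ge : forall f : X -> R, measurable_fun [set: X] f ->
  (c%:E * nonlocal_energy mu J f <= S f)%E.
Hypothesis S_le : forall f : X -> R, measurable_fun [set: X] f ->
  (S f <= C%:E * nonlocal_energy mu J f)%E.
Implicit Types f : X -> R.

Let energy_ge0 f : (0 <= nonlocal_energy mu J f)%E.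
Proof.
by apply: integral_ge0 => y _; apply: integral_ge0 => x _; rewrite lee_fin mulr_ge0.
Qed.

Let mlevel f s : measurable_fun [set: X] f ->
  measurable_fun [set: X] (\1_(superlevel f s) : X -> R).
Proof. by move=> mf; exact/measurable_indic/measurable_superlevel. Qed.

Let S_ge0 f : measurable_fun [set: X] f -> (0 <= S f)%E.
Proof. by move=> /S_ge; apply: le_trans; rewrite mule_ge0// lee_fin ltW. Qed.

(** The positive part of [f] has the same superlevel sets at positive levels and
    the same energy. *)
Lemma ae_nonlocal_energy_coarea f : measurable_fun [set: X] f ->
  (\forall x \ae mu, 0 <= f x) ->
  (nonlocal_energy mu J f = \int[lebesgue_measure]_(s in `]0%R, +oo[)
     nonlocal_energy mu J (\1_(superlevel f s)))%E.
Proof.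
move=> mf f0; pose g x := Num.max (f x) 0.
have mg : measurable_fun [set: X] g by exact: measurable_maxr.
rewrite (ae_eq_nonlocal_energy J0 mJ mf mg); last first.
  by apply: filterS f0 => x fx0; rewrite /g max_l.
rewrite (nonlocal_energy_coarea mu J0 mJ mg); last by move=> x; rewrite /g le_max lexx orbT.
apply: eq_integral => s; rewrite inE/= in_itv/= andbT => s0.
congr (nonlocal_energy _ _ \1_(_)); apply/seteqP; split => x /=.
  by rewrite /superlevel/= /g lt_max => /orP[//|/(lt_trans s0)]; rewrite ltxx.
by rewrite /superlevel/= /g lt_max => ->.
Qed.

(** The functional [S] is compared with the energy level by level, under the
    integral, where [t |-> S (\1_(superlevel f t))] may fail to be measurable. *)
Lemma seminorm_coarea : exists C1 C2 : R, [/\ 0 < C1, 0 < C2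
  & forall f, measurable_fun [set: X] f -> (\forall x \ae mu, 0 <= f x) ->
      (C1%:E * \int[lebesgue_measure]_(t in `]0%R, +oo[) S (\1_(superlevel f t))
        <= S f)%E /\
      (S f <= C2%:E *
        \int[lebesgue_measure]_(t in `]0%R, +oo[) S (\1_(superlevel f t)))%E].
Proof.
exists (c / C), (C / c); split; [exact: divr_gt0|exact: divr_gt0|move=> f mf f0].
have mI : measurable_fun (`]0%R, +oo[ : set R)
    (fun s => nonlocal_energy mu J (\1_(superlevel f s))).
  by apply: measurable_funTS; exact: measurable_nonlocal_energy_superlevel.
have scale (k : R) : 0 <= k -> (\int[lebesgue_measure]_(s in `]0%R, +oo[)
    (k%:E * nonlocal_energy mu J (\1_(superlevel f s))) =
    k%:E * nonlocal_energy mu J f)%E.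
  by move=> k0; rewrite (ae_nonlocal_energy_coarea mf f0) ge0_integralZl_EFin.
split.
- apply: (@le_trans _ _ ((c / C)%:E * (C%:E * nonlocal_energy mu J f))%E).
    apply: lee_wpmul2l; first by rewrite lee_fin ltW// divr_gt0.
    rewrite -scale ?(ltW C0)//; apply: ge0_le_integral_nonmeasurable => s _.
      exact/S_ge0/mlevel.
    exact/S_le/mlevel.
  by rewrite muleA -EFinM divfK ?gt_eqF// S_ge.
- apply: (le_trans (S_le mf)).
  have -> : C%:E = ((C / c)%:E * c%:E)%E by rewrite -EFinM divfK// gt_eqF.
  rewrite -muleA; apply: lee_wpmul2l; first by rewrite lee_fin ltW// divr_gt0.
  rewrite -scale ?(ltW c0)//; apply: ge0_le_integral_nonmeasurable => s _.
    by rewrite mule_ge0// lee_fin ltW.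
  exact/S_ge/mlevel.
Qed.

Lemma ae_superlevel_seminorm_lty f : measurable_fun [set: X] f ->
  (\forall x \ae mu, 0 <= f x) -> (S f < +oo)%E ->
  \forall t \ae (@lebesgue_measure R), 0 < t -> (S (\1_(superlevel f t)) < +oo)%E.
Proof.
move=> mf f0 Sf.
have mI := measurable_nonlocal_energy_superlevel mu J0 mJ mf.
have Ef : (nonlocal_energy mu J f < +oo)%E.
  have := le_lt_trans (S_ge mf) Sf; case: (nonlocal_energy mu J f) (energy_ge0 f) => //.
    by move=> r _ _; exact: ltry.
  by rewrite mulry gtr0_sg// mul1e.
have /integrable_ae : lebesgue_measure.-integrable (`]0%R, +oo[ : set R)
    (fun s => nonlocal_energy mu J (\1_(superlevel f s))).
  apply/integrableP; split; first exact: measurable_funTS.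
  under eq_integral do rewrite gee0_abs//.
  by rewrite -ae_nonlocal_energy_coarea.
move=> /(_ (measurable_itv _)); apply: filterS => t + t0.
rewrite /= in_itv/= t0 => /(_ isT) Et; apply: le_lt_trans (S_le (mlevel _ mf)) _.
by rewrite -(fineK Et) -EFinM ltry.
Qed.

End coarea_comparison.

(** Superlevel sets at positive levels have finite measure by Chebyshev's
    inequality. *)
Lemma Lfun1_indic_superlevel d (R : realType) (X : borelMetricType d R)
    (mu : {measure set X -> \bar R}) (f : X -> R) (t : R) : 0 < t ->
  f \in Lfun mu 1%:E -> \1_(superlevel f t) \in Lfun mu 1%:E.
Proof.
move=> t0 /Lfun1_integrable /integrableP[/measurable_EFinP mf intf].
have ml := measurable_superlevel t mf.
apply/Lfun1_integrable/integrableP; split; first exact/measurable_EFinP/measurable_indic.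
have tl : (t%:E * mu (superlevel f t) < +oo)%E.
  apply: le_lt_trans intf; rewrite -[superlevel f t]setIT -integral_indic//.
  rewrite -ge0_integralZl_EFin ?(ltW t0)//; last exact/measurable_EFinP/measurable_indic.
  apply: ge0_le_integral_nonmeasurable => x _; first by rewrite mule_ge0// lee_fin ltW.
  rewrite indicE; have [/set_mem tf|_] := boolP (x \in superlevel f t).
    by rewrite mule1 lee_fin ler_normr (ltW tf).
  by rewrite mule0.
under eq_integral do rewrite /= ger0_norm//.
rewrite integral_indic// setIT; move: tl.
case: (mu _) (measure_ge0 mu (superlevel f t)) => // [r _ _|_]; first exact: ltry.
by rewrite mulry gtr0_sg// mul1e.
Qed.

Theorem theorem4p7 (d : measure_display) (R : realType)
  (X : borelMetricType d R) (mu : {measure set X -> \bar R})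
  (F : set (X -> R)) (E : (X -> R) -> (X -> R) -> R)
  (P : R -> (X -> R) -> X -> R) (p : R -> X -> X -> R)
  (dH dW kappa delta : R) (eta : R -> R -> R)
  (X_locally_compact : locally_compact [set: X])
  (mu_radon : radon_measure mu) (mu_support : full_support mu)
  (E_dirichlet : dirichlet_form mu F E)
  (P_heat : heat_semigroup mu F E P)
  (A1 : balls_relatively_compact X)
  (A2 : ahlfors_regular mu dH)
  (A3_regular : regular_form mu F E) (A3_local : strongly_local mu F E)
  (p_kernel : continuous_heat_kernel mu P p)
  (HK : heat_kernel_estimates mu dH dW p)
  (kappa_bounds : 0 < kappa < dW)
  (kappa_def : (dW - kappa)%:E = KS_critical_exponent mu)
  (BE : weak_bakry_emery mu kappa dW p)
  (delta_bounds : 0 < delta < 1)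
  (eta_density : subordinator_density delta eta)
  (alpha1 : besov_critical_exponent mu (subordinated_kernel eta p) 1 = 1%:E) :
  let q := subordinated_kernel eta p in
  (exists C1 C2 : R, [/\ 0 < C1, 0 < C2
    & forall f : X -> R, f \in Lfun mu 1%:E ->
        (\forall x \ae mu, 0 <= f x) ->
        (C1%:E * \int[lebesgue_measure]_(t in `]0%R, +oo[)
           besov_seminorm mu q 1 1 (\1_(superlevel f t))
         <= besov_seminorm mu q 1 1 f)%E /\
        (besov_seminorm mu q 1 1 f <=
         C2%:E * \int[lebesgue_measure]_(t in `]0%R, +oo[)
           besov_seminorm mu q 1 1 (\1_(superlevel f t)))%E ]) /\
  (forall f : X -> R, besov mu q 1 1 f -> (\forall x \ae mu, 0 <= f x) ->
     \forall t \ae (@lebesgue_measure R), 0 < t ->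
       besov mu q 1 1 (\1_(superlevel f t))) /\
  (forall f : X -> R, f \in Lfun mu 1%:E -> (\forall x \ae mu, 0 <= f x) ->
     (\forall t \ae (@lebesgue_measure R), 0 < t ->
       besov mu q 1 1 (\1_(superlevel f t))) ->
     (\int[lebesgue_measure]_(t in `]0%R, +oo[)
        besov_seminorm mu q 1 1 (\1_(superlevel f t)) < +oo)%E ->
     besov mu q 1 1 f).
Proof.
move=> q; have [pc _] := p_kernel; have [dH0 _] := A2.
have sf := ahlfors_sigma_finite A2.
(* [mu] with its sigma-finite structure, as Tonelli's theorem requires *)
pose sfinite_mixin := isSFinite.Build _ _ _ mu (sfinite_measure_sigma_finite sf).
pose sigma_finite_mixin := isSigmaFinite.Build _ _ _ mu sf.
pose m := HB.pack_for (SigmaFiniteMeasure.type X R) (Measure.sort mu)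
  sfinite_mixin sigma_finite_mixin.
have [C C0 qC] := subordinated_kernel_le mu_support pc HK dH0 eta_density.
have [c c0 qc] := subordinated_kernel_ge mu_support pc HK dH0 delta_bounds eta_density.
have q0 := subordinated_kernel_ge0 mu_support pc HK eta_density.
pose J : X -> X -> R := jump_kernel dH dW delta.
pose rho (x y : X) : R := mdist x y `^ (delta * dW) / 8.
have J0 x y : 0 <= J x y by exact: powR_ge0.
have mdist_powR a : measurable_fun [set: X * X] (fun z : X * X => mdist z.1 z.2 `^ a).
  exact: measurable_mdist_powR.
have mJ : measurable_fun [set: X * X] (fun z : X * X => J z.1 z.2) by exact: mdist_powR.
have mrho : measurable_fun [set: X * X] (fun z : X * X => rho z.1 z.2).
  by apply: measurable_funM => //; exact: mdist_powR.
have rho0 x y : x != y -> 0 < rho x y.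
  by move=> xy; rewrite divr_gt0// powR_gt0// mdist_gt0.
pose S := besov_seminorm mu q 1 1.
have S_le f (mf : measurable_fun [set: X] f) : (S f <= C%:E * nonlocal_energy m J f)%E.
  exact: (@besov_seminorm_le _ _ _ m q J q0 J0 mJ C f (ltW C0) qC mf).
have S_ge f (mf : measurable_fun [set: X] f) : (c%:E * nonlocal_energy m J f <= S f)%E.
  exact: (@besov_seminorm_ge _ _ _ m q J q0 J0 mJ c rho f c0 rho0 mrho qc mf).
have Lfun_measurable f : f \in Lfun mu 1%:E -> measurable_fun [set: X] f.
  by move=> /Lfun1_integrable/integrableP[/measurable_EFinP].
have [C1 [C2 [C10 C20 CC]]] := @seminorm_coarea _ _ _ m J J0 mJ S c C c0 C0 S_ge S_le.
split; last split.
- by exists C1, C2; split => // f /Lfun_measurable mf f0; exact: CC.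
- move=> f [fL1 Sf] f0; have mf := Lfun_measurable _ fL1.
  have := @ae_superlevel_seminorm_lty _ _ _ m J J0 mJ S c C c0 S_ge S_le f mf f0 Sf.
  move=> [N [mN N0 SN]]; exists N; split => // t nt; apply: SN => /= St; apply: nt => t0.
  by split; [exact: Lfun1_indic_superlevel|exact: St].
- move=> f fL1 f0 _ If; split=> //.
  have [_ /le_lt_trans] := CC f (Lfun_measurable _ fL1) f0; apply.
  by rewrite lte_mul_pinfty// lee_fin ltW.
Qed.
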